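(* Let $A$ be a $C^*$-algebra, $G$ a topological group, and $\alpha\colon G\to\operatorname{Aut}(A)$, $g\mapsto\alpha_g$, a group homomorphism such that for each $x\in A$ the map $g\mapsto\alpha_g(x)$ is continuous with respect to the norm topology of $A$. Then the following hold: (a) If $G$ is amenable, then there exists a completely bounded idempotent linear mapping $Q\colon A^*\to A^*$ whose range consists of all $\phi\in A^*$ which are $\alpha$-invariant, i.e. $\phi(\alpha_g(x))=\phi(x)$ for all $g\in G$ and all $x\in A$. Moreover, if $A$ is unital, then $Q(S(A))\subseteq S(A)$, where $S(A)$ is the set of all states of $A$; hence $Q$ maps the set of all states of $A$ onto the set of all $\alpha$-invariant states. (b) If $G$ is a compact group, then there exists a completely positive and completely contractive idempotent linear mapping $P\colon A\to A$ with $\operatorname{Ran}P=\{x\in A\mid\alpha_g(x)=x\text{ for all }g\in G\}$.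
   Context: $\operatorname{Aut}(A)$ is the group of $*$-automorphisms of $A$. $A^*$ is equipped with its operator space dual structure. Amenable topological group: for a topological group $G$ and $f\colon G\to\mathbb C$ bounded, put $(L_tf)(s)=f(ts)$. Let $\mathcal{RUC}_b(G)$ be the space of all bounded continuous $f\colon G\to\mathbb C$ such that $s\mapsto L_sf$ is continuous in the sup norm. $G$ is amenable if there is a linear functional $\mu$ on $\mathcal{RUC}_b(G)$ with $\|\mu\|=\mu(\mathbf 1)=1$ and $\mu\circ L_t=\mu$ for all $t\in G$. *)

(* Defs.v *)
From HB Require Import structures.
From mathcomp Require Import all_boot all_order all_algebra.
From mathcomp Require Import complex.
From mathcomp Require Import all_classical all_reals all_analysis.
Set Implicit Arguments.
Unset Strict Implicit.
Unset Printing Implicit Defensive.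
Import Order.TTheory GRing.Theory Num.Theory.
Import numFieldNormedType.Exports.
Local Open Scope classical_set_scope.
Local Open Scope ring_scope.

(* The complex field [R[i]], repackaged as a [numClosedFieldType] so that its
   elements have a type of the form [Num.ClosedField.sort _], the key under
   which MathComp-Analysis finds the topology given by the modulus. *)
Definition Cplx (R : realType) : numClosedFieldType := R[i]%C.

(* In a normed module over [Cplx R] the library norm takes its values in
   [Cplx R]; this is the same nonnegative number, read in [R]. *)
Definition rnorm (R : realType) (V : normedModType (Cplx R)) (x : V) : R :=
  complex.Re (`|x| : Cplx R).

(* C*-algebras are not assumed to be unital. *)
HB.mixin Record CompleteNormedModule_isCStarAlgebra (R : realType) A
    of CompleteNormedModule (Cplx R) A := {
  cmul : A -> A -> A ;
  cstar : A -> A ;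
  cmulA : associative cmul ;
  cmulDl : left_distributive cmul +%R ;
  cmulDr : right_distributive cmul +%R ;
  cmulZl : forall (a : Cplx R) (x y : A), cmul (a *: x) y = a *: cmul x y ;
  cmulZr : forall (a : Cplx R) (x y : A), cmul x (a *: y) = a *: cmul x y ;
  cstarK : involutive cstar ;
  cstarD : {morph cstar : x y / x + y} ;
  cstarZ : forall (a : Cplx R) (x : A), cstar (a *: x) = a^* *: cstar x ;
  cstarM : forall x y : A, cstar (cmul x y) = cmul (cstar y) (cstar x) ;
  cnormM : forall x y : A, `|cmul x y| <= `|x| * `|y| ;
  cnorm_star_mul : forall x : A, `|cmul (cstar x) x| = `|x| ^+ 2
}.

#[short(type="cstarAlgType")]
HB.structure Definition CStarAlgebra (R : realType) :=
  {A of CompleteNormedModule_isCStarAlgebra R A &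
        CompleteNormedModule (Cplx R) A}.

Definition is_unit_elt (R : realType) (A : cstarAlgType R) (e : A) : Prop :=
  forall x, cmul e x = x /\ cmul x e = x.

Definition unital (R : realType) (A : cstarAlgType R) : Prop :=
  exists e : A, is_unit_elt e.

Definition star_automorphism (R : realType) (A : cstarAlgType R)
    (f : A -> A) : Prop :=
  [/\ bijective f,
      forall (a : Cplx R) (x y : A), f (a *: x + y) = a *: f x + f y,
      forall x y, f (cmul x y) = cmul (f x) (f y) &
      forall x, f (cstar x) = cstar (f x)].

(* Multiplicative topological groups; no separation axiom is imposed. *)
HB.mixin Record isTopologicalGroup G of Topological G & Group G := {
  mulg_continuous : continuous (fun p : G * G => (p.1 * p.2)%g) ;
  invg_continuous : continuous (fun g : G => (g^-1)%g)
}.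

#[short(type="topGroupType")]
HB.structure Definition TopologicalGroup :=
  {G of isTopologicalGroup G & Topological G & Group G}.

(* Group homomorphisms from [G] to Aut(A), the latter being a group under
   composition. *)
Definition is_action (R : realType) (A : cstarAlgType R) (G : topGroupType)
    (alpha : G -> A -> A) : Prop :=
  (forall g, star_automorphism (alpha g)) /\
  (forall g h, alpha (g * h)%g = alpha g \o alpha h).

Definition ltrans (G : topGroupType) (T : Type) (t : G) (f : G -> T) : G -> T :=
  fun s => f (t * s)%g.

(* On bounded functions the topology of [{uniform G -> Cplx R}] is that of the
   sup norm. *)
Definition RUCb (R : realType) (G : topGroupType) (f : G -> Cplx R) : Prop :=
  [/\ continuous f,
      exists M : Cplx R, forall s, `|f s| <= M &
      continuous (fun s : G => ltrans s f : {uniform G -> Cplx R})].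

(* [mu] is a total function, of which only the restriction to [RUCb] matters. *)
Definition amenable (R : realType) (G : topGroupType) : Prop :=
  exists mu : (G -> Cplx R) -> Cplx R,
  [/\ forall (a : Cplx R) (f g : G -> Cplx R), RUCb f -> RUCb g ->
        mu (fun s => a * f s + g s) = a * mu f + mu g,
      ereal_sup [set r : \bar R | exists f : G -> Cplx R,
        [/\ RUCb f, forall s, `|f s| <= 1 & r = (complex.Re `|mu f|)%:E]] = 1%E,
      mu (fun=> 1) = 1 &
      forall (t : G) (f : G -> Cplx R), RUCb f -> mu (ltrans t f) = mu f].

Section Dual.
Variables (R : realType) (A : cstarAlgType R).

Definition dual_pred : {pred A -> (Cplx R)^o} :=
  [pred f : A -> (Cplx R)^o | `[<
    (forall (a : Cplx R) (x y : A), f (a *: x + y) = a *: f x + f y)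
    /\ continuous f >]].

Lemma dual_submod_closed : submod_closed dual_pred.
Proof.
split.
  apply/asboolP; split; last exact: cst_continuous.
  by move=> a x y /=; rewrite scaler0 addr0.
move=> c f g /asboolP[lf cf] /asboolP[lg cg]; apply/asboolP; split.
  move=> a x y; rewrite !fctE /= lf lg !scalerDr !scalerA (mulrC c a).
  by rewrite addrACA.
move=> x; apply: (@continuousD _ _ _ (c *: f) g); last exact: cg.
by apply: continuousZl_tmp; exact: cf.
Qed.

HB.instance Definition _ :=
  GRing.isSubmodClosed.Build (Cplx R) (A -> (Cplx R)^o) dual_pred
    dual_submod_closed.

Record dual := Dual {
  dual_fun :> A -> (Cplx R)^o ;
  _ : dual_fun \in dual_pred
}.

HB.instance Definition _ := [isSub for dual_fun].
HB.instance Definition _ := [Choice of dual by <:].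
HB.instance Definition _ := [SubChoice_isSubLmodule of dual by <:].

End Dual.

Definition dual_norm (R : realType) (A : cstarAlgType R) (phi : dual A) :
    \bar R :=
  ereal_sup [set (rnorm (phi x))%:E | x in [set x : A | rnorm x <= 1]].

Definition state (R : realType) (A : cstarAlgType R) : set (dual A) :=
  [set phi : dual A | (forall x : A, 0 <= (phi (cmul (cstar x) x) : Cplx R)) /\
             dual_norm phi = 1%E].

Definition invariant_functional (R : realType) (A : cstarAlgType R)
    (G : topGroupType) (alpha : G -> A -> A) : set (dual A) :=
  [set phi : dual A | forall g x, phi (alpha g x) = phi x].

Section MatrixAlgebra.
Variables (R : realType) (A : cstarAlgType R).

Definition cmulmx (m n p : nat) (X : 'M[A]_(m, n)) (Y : 'M[A]_(n, p)) :
    'M[A]_(m, p) :=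
  \matrix_(i, k) \sum_j cmul (X i j) (Y j k).

Definition cstarmx (m n : nat) (X : 'M[A]_(m, n)) : 'M[A]_(n, m) :=
  \matrix_(i, j) cstar (X j i).

Definition mx_positive (n : nat) (X : 'M[A]_n) : Prop :=
  exists Y : 'M[A]_n, X = cmulmx (cstarmx Y) Y.

(* The norm of the right Hilbert A-module A^n: the square root of
   || \sum_i v_i^* v_i ||. *)
Definition hilbert_norm (n : nat) (v : 'cV[A]_n) : R :=
  Num.sqrt (rnorm (\sum_i cmul (cstar (v i 0)) (v i 0))).

(* The C*-norm of M_n(A).  Left multiplication is a faithful representation of
   M_n(A) by adjointable operators on the Hilbert A-module A^n, so the operator
   norm is the unique C*-norm. *)
Definition cstar_mxnorm (n : nat) (X : 'M[A]_n) : \bar R :=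
  ereal_sup [set (hilbert_norm (cmulmx X v))%:E |
              v in [set v : 'cV[A]_n | hilbert_norm v <= 1]].

End MatrixAlgebra.

Definition l2norm (R : realType) (n : nat) (v : 'cV[Cplx R]_n) : R :=
  Num.sqrt (\sum_i (complex.Re `|v i 0|) ^+ 2).

(* The operator norm on the Hilbert space C^n; the norm that the library puts
   on matrices is the maximum of the moduli of the entries. *)
Definition scalar_opnorm (R : realType) (n : nat) (X : 'M[Cplx R]_n) : \bar R :=
  ereal_sup [set (l2norm (X *m v))%:E |
              v in [set v : 'cV[Cplx R]_n | l2norm v <= 1]].

(* An operator space structure on [V], as the family of norms of the spaces
   M_n(V). *)
Definition mxnorms (R : realType) (V : Type) : Type :=
  forall n : nat, 'M[V]_n -> \bar R.

Definition cb_norm (R : realType) (V W : Type) (NV : mxnorms R V)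
    (NW : mxnorms R W) (u : V -> W) : \bar R :=
  ereal_sup [set r | exists n (X : 'M[V]_n),
                       (NV n X <= 1)%E /\ r = NW n (map_mx u X)].

Definition completely_bounded (R : realType) (V W : Type) (NV : mxnorms R V)
    (NW : mxnorms R W) (u : V -> W) : Prop :=
  (cb_norm NV NW u < +oo)%E.

Definition completely_contractive (R : realType) (V W : Type)
    (NV : mxnorms R V) (NW : mxnorms R W) (u : V -> W) : Prop :=
  (cb_norm NV NW u <= 1)%E.

Definition cstar_os (R : realType) (A : cstarAlgType R) : mxnorms R A :=
  fun n X => cstar_mxnorm X.

(* M_k(M_n(C)) = M_(kn)(C). *)
Definition scalar_mx_os (R : realType) (n : nat) : mxnorms R 'M[Cplx R]_n :=
  fun k X => scalar_opnorm (\mxblock_(i < k, j < k) (X i j)).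

(* M_n(A^* ) = CB(A, M_n(C)). *)
Definition dual_os (R : realType) (A : cstarAlgType R) : mxnorms R (dual A) :=
  fun n Phi => cb_norm (@cstar_os R A) (@scalar_mx_os R n)
    (fun x : A => \matrix_(i < n, j < n) (Phi i j x : Cplx R)).

Definition completely_positive (R : realType) (A : cstarAlgType R)
    (u : A -> A) : Prop :=
  forall (n : nat) (X : 'M[A]_n), mx_positive X -> mx_positive (map_mx u X).

(* Main.v *)
(* (a) Let mu be an invariant mean and put (Q phi)(x) = mu(s |-> phi(alpha_(s^-1) x)).
   *-automorphisms are completely isometric, so mu, being contractive, makes Q
   completely contractive; for unital A positivity of mu and phi(1) = ||phi||
   show that Q preserves states.

   (b) Instead of a Haar measure, take convex combinations T of the alpha_g.  On a
   compact group, averaging a continuous real function over suitable right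
   translates shrinks its oscillation by a fixed factor; with a partition of
   unity this gives, for finitely many x at once, a T with alpha_g (T x) almost
   independent of g.  The same for left translates makes the limit P x unique.
   T is completely contractive, and so is P; T maps squares y^* y of M_n(A) to
   sums of squares, and P maps them to limits of such sums, which are squares.

   That cone is reached without spectral theory.  The square root of 1 - z for
   z = z^*, ||z|| <= 1 is the limit of a quadratic iteration; if b, c commute,
   are self-adjoint and b^2 + c^2 = t, then ||b + i c||^2 = t, which gives
   ||b||^2 <= t and replaces the spectral radius.  This yields the isometry of
   *-automorphisms and Kaplansky's theorem x^* x >= 0 in the unitization of A;
   matrices over it are then ordered by their quadratic forms on the Hilbert
   module. *)
Require Import Defs.
From HB Require Import structures.
From mathcomp Require Import all_boot all_order all_algebra.
From mathcomp Require Import complex.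
From mathcomp Require Import all_classical all_reals all_analysis.
From mathcomp Require Import ring lra.
From Stdlib Require Ncring Ncring_tac.
Import Order.TTheory GRing.Theory Num.Theory.
Import numFieldNormedType.Exports.
Local Open Scope classical_set_scope.
Local Open Scope ring_scope.

Set Implicit Arguments.
Unset Strict Implicit.
Unset Printing Implicit Defensive.

(** The obstacle in (b) is that [mx_positive] asks for a factorization with entries in A, which no
    limit carries along. Positivity of a quadratic form, on the other hand, survives convex
    combinations and limits, and the work lies in returning from forms to squares. This calls for
    square roots both in the unitization and in matrices over it, so the iteration is carried out
    once, for an abstract family of balls covering both. For matrices, positivity of the form
    supplies the estimate ||t - H|| <= t from which the iteration starts.

    Convex combinations of the alpha_g are asked to be near their limit after every translation by
    g. A requirement of this kind is not destroyed by averaging further, so finitely many of them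
    can be met one after another by convolution. *)

#[export] Instance pzRing_Ncring_ops (U : pzRingType) : @Ncring.Ring_ops U 0 1 +%R *%R
  (fun x y => x - y) -%R eq := {}.
#[export] Instance pzRing_Ncring (U : pzRingType) : @Ncring.Ring U _ _ _ _ _ _ _ _.
Proof.
constructor.
1: exact: RelationClasses.eq_equivalence.
1-4: by repeat move=> ? ? ->.
- exact: add0r.
- exact: addrC.
- exact: addrA.
- exact: mul1r.
- exact: mulr1.
- exact: mulrA.
- exact: mulrDl.
- by move=> x y z; exact: mulrDr.
- by [].
- exact: subrr.
Qed.
Ltac nc := Ncring_tac.non_commutative_ring.

(** * Square roots and positivity in a C*-algebra described by its balls *)

(* [bd t x] stands for [||x|| <= t]: working with balls instead of a norm
   avoids defining operator norms as suprema. *)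
Record is_star_ball (R : realType) (U : pzRingType) (rs : {rmorphism R -> U})
    (st : U -> U) (bd : R -> U -> Prop) : Prop := IsStarBall {
  rsC : forall a x, rs a * x = x * rs a ;
  stK : involutive st ;
  stD : {morph st : x y / x + y} ;
  stM : forall x y, st (x * y) = st y * st x ;
  st_rs : forall a, st (rs a) = rs a ;
  bd_ge0 : forall t x, bd t x -> 0 <= t ;
  bdD : forall s t x y, bd s x -> bd t y -> bd (s + t) (x + y) ;
  bdM : forall s t x y, bd s x -> bd t y -> bd (s * t) (x * y) ;
  bd_rs : forall a, bd `|a| (rs a) ;
  bd_le : forall s t x, s <= t -> bd s x -> bd t x ;
  bd_ex : forall x, exists t, bd t x ;
  bd_eps : forall t x, (forall e, 0 < e -> bd (t + e) x) -> bd t x ;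
  bd0 : forall x, bd 0 x -> x = 0 ;
  bd_st : forall t x, bd t x -> bd t (st x) ;
  bd_complete : forall (x : nat -> U) (r : nat -> R) M,
    (forall k, r k <= M) -> (forall k, bd (r k.+1 - r k) (x k.+1 - x k)) ->
    exists l, forall e, 0 < e ->
      exists K, forall k, (K <= k)%N -> bd e (l - x k)
}.

Section StarBall.
Variables (R : realType) (U : pzRingType) (rs : {rmorphism R -> U})
  (st : U -> U) (bd : R -> U -> Prop) (H : is_star_ball rs st bd).

Let stD := stD H.
Let stM := stM H.
Let stK := stK H.

Lemma st0 : st 0 = 0.
Proof. by apply: (addrI (st 0)); rewrite -stD !addr0. Qed.

Lemma stN x : st (- x) = - st x.
Proof. by apply: (addrI (st x)); rewrite -stD !subrr st0. Qed.

Lemma stB x y : st (x - y) = st x - st y.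
Proof. by rewrite stD stN. Qed.

Lemma st1 : st 1 = 1.
Proof. by rewrite -(rmorph1 rs) (st_rs H). Qed.

Lemma bd_rsM a t x : bd t x -> bd (`|a| * t) (rs a * x).
Proof. by move=> h; apply: (bdM H) => //; exact: (bd_rs H). Qed.

Lemma bd1 : bd 1 1.
Proof. by have := bd_rs H 1; rewrite normr1 rmorph1. Qed.

Lemma bdN t x : bd t x -> bd t (- x).
Proof. by move/(bd_rsM (-1)); rewrite normrN normr1 mul1r rmorphN1 mulN1r. Qed.

Lemma bdB s t x y : bd s x -> bd t y -> bd (s + t) (x - y).
Proof. by move=> hx /bdN; exact: (bdD H). Qed.

Lemma bd_eq0 x : (forall e, 0 < e -> bd e x) -> x = 0.
Proof. by move=> h; apply: (bd0 H); apply: (bd_eps H) => e /h; rewrite add0r. Qed.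

Lemma bd00 : bd 0 0.
Proof. by have := bd_rs H 0; rewrite normr0 rmorph0. Qed.

Lemma rsMM s t x y : rs s * x * (rs t * y) = rs (s * t) * (x * y).
Proof. by rewrite rmorphM -!mulrA; congr (_ * _); rewrite mulrA -(rsC H) mulrA. Qed.

Lemma rs_half x : rs 2^-1 * (x + x) = x.
Proof.
rewrite -[in LHS](mul1r x) -mulrDl mulrA -(rmorph1 rs) -rmorphD -rmorphM.
by rewrite -[1 + 1]/(2%:R) mulVf ?rmorph1 ?mul1r // pnatr_eq0.
Qed.

Fixpoint sqrt_majorant (k : nat) : R :=
  if k is k'.+1 then 2^-1 * (1 + sqrt_majorant k' ^+ 2) else 0.

Fixpoint sqrt_iter (z : U) (k : nat) : U :=
  if k is k'.+1 then rs 2^-1 * (z + sqrt_iter z k' * sqrt_iter z k') else 0.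

Lemma sqrt_majorant_bounds k : 0 <= sqrt_majorant k <= 1.
Proof.
elim: k => [|k /andP[h0 h1]] /=; first by rewrite lexx ler01.
by apply/andP; split; nra.
Qed.

Lemma sqrt_iter_bound z k : bd 1 z -> bd (sqrt_majorant k) (sqrt_iter z k).
Proof.
move=> hz; elim: k => [|k IH] /=; first exact: bd00.
have := bd_rsM 2^-1 (bdD H hz (bdM H IH IH)).
by rewrite ger0_norm ?invr_ge0 // expr2.
Qed.

Lemma sqrt_iter_step z k : bd 1 z ->
  bd (sqrt_majorant k.+1 - sqrt_majorant k) (sqrt_iter z k.+1 - sqrt_iter z k).
Proof.
move=> hz; elim: k => [|k IH].
  by rewrite /= !subr0 mul0r addr0 expr0n addr0 mulr1;
    have := bd_rsM 2^-1 hz; rewrite ger0_norm ?invr_ge0 // mulr1.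
(* A difference of squares split without commuting the iterates; [e2] is the same identity for the
   majorant, so the bounds multiply term by term. *)
have e1 : sqrt_iter z k.+2 - sqrt_iter z k.+1 = rs 2^-1 *
    (sqrt_iter z k.+1 * (sqrt_iter z k.+1 - sqrt_iter z k) +
     (sqrt_iter z k.+1 - sqrt_iter z k) * sqrt_iter z k).
  rewrite {1}[sqrt_iter z k.+2]/= -/(sqrt_iter z k.+1) {3}[sqrt_iter z k.+1]/=.
  rewrite -mulrBr; congr (_ * _); nc.
have e2 : sqrt_majorant k.+2 - sqrt_majorant k.+1 = `|2^-1| *
    (sqrt_majorant k.+1 * (sqrt_majorant k.+1 - sqrt_majorant k) +
     (sqrt_majorant k.+1 - sqrt_majorant k) * sqrt_majorant k).
  rewrite ger0_norm ?invr_ge0 //.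
  have : sqrt_majorant k.+1 = 2^-1 * (1 + sqrt_majorant k ^+ 2) by [].
  have -> : sqrt_majorant k.+2 = 2^-1 * (1 + sqrt_majorant k.+1 ^+ 2) by [].
  by move: (sqrt_majorant k.+1) (sqrt_majorant k) => r1 r0; lra.
rewrite e1 e2; apply/bd_rsM/(bdD H); apply: (bdM H) => //;
  exact: sqrt_iter_bound.
Qed.

(* The iteration [v := (z + v ^ 2) / 2], dominated by the same scalar iteration
   started with [z = 1], converges to a solution of [(1 - v) ^ 2 = 1 - z]. *)
Lemma sqrt_one_minus z : st z = z -> bd 1 z ->
  exists v, [/\ st v = v, bd 1 v, (1 - v) * (1 - v) = 1 - z &
                forall y, y * z = z * y -> y * v = v * y].
Proof.
move=> stz hz.
have [|v hv] := bd_complete H (x := sqrt_iter z) (M := 1) _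
  (fun k => sqrt_iter_step k hz).
  by move=> k; case/andP: (sqrt_majorant_bounds k).
have hv1 e : 0 < e -> exists k, bd e (v - sqrt_iter z k).
  by move=> /hv[K hK]; exists K; exact: hK.
have it1 k : bd 1 (sqrt_iter z k).
  by apply: (bd_le H) (sqrt_iter_bound k hz); case/andP: (sqrt_majorant_bounds k).
have v1 : bd 1 v.
  apply: (bd_eps H) => e /hv1[k hk].
  by have := bdD H (it1 k) hk; rewrite subrKC.
exists v; split => //.
- apply/subr0_eq/bd_eq0 => e e0.
  have [k hk] := hv1 _ (divr_gt0 e0 (ltr0n _ 2)).
  have stk : st (sqrt_iter z k) = sqrt_iter z k.
    elim: k {hk} => [|k IH] /=; first exact: st0.
    by rewrite stM stD stM (st_rs H) stz IH (rsC H).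
  have := bdB (bd_st H hk) hk; rewrite stB stk -splitr => {}h.
  by have -> : st v - v = st v - sqrt_iter z k - (v - sqrt_iter z k);
    rewrite // opprB addrA subrK.
(* [E] is the fixed point equation of the iteration. Replacing v by iterates leaves four errors, two
   from [v - s1] and two from [v - s] times a factor of norm at most 1: hence e / 4. *)
- suff E : v + v = z + v * v by rewrite -(addrK (v * v) z) -E; nc.
  apply/subr0_eq/bd_eq0 => e e0.
  have [K hK] := hv _ (divr_gt0 e0 (ltr0n _ 4)).
  have hk := hK K (leqnn _); have hk1 := hK K.+1 (leqnSn _).
  set s := sqrt_iter z K in hk.
  have E : sqrt_iter z K.+1 + sqrt_iter z K.+1 = z + s * s.
    by rewrite /= -mulrDr rs_half.
  move: hk1 E; set s1 := sqrt_iter z K.+1 => hk1 E.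
  have := bdB (bdD H hk1 hk1) (bdD H (bdM H v1 hk) (bdM H hk (it1 K))).
  rewrite -/s mul1r mulr1.
  have -> : e / 4%:R + e / 4%:R + (e / 4%:R + e / 4%:R) = e by field.
  suff -> : v - s1 + (v - s1) - (v * (v - s) + (v - s) * s) = v + v - (z + v * v) by [].
  by rewrite -(addrK (s * s) z) -E; nc.
- move=> y yz; apply/subr0_eq/bd_eq0 => e e0.
  have [t ht] := bd_ex H y; have t0 := bd_ge0 H ht.
  have t1 : 0 < 2 * (t + 1) by lra.
  have d0 := divr_gt0 e0 t1.
  have := divfK (lt0r_neq0 t1) e; move: (e / _) d0 => d d0 de.
  have [k hk] := hv1 _ d0.
  have ys : y * sqrt_iter z k = sqrt_iter z k * y.
    elim: k {hk} => [|k IH] /=; first by rewrite mulr0 mul0r.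
    rewrite mulrA -(rsC H) -!mulrA; congr (_ * _).
    by rewrite mulrDr yz mulrA IH -mulrA IH; nc.
  have := bdB (bdM H ht hk) (bdM H hk ht).
  rewrite mulrBr mulrBl ys opprB addrA subrK; apply: (bd_le H).
  lra.
Qed.

(** For self-adjoint a in a C*-algebra, ||t - a|| <= t says that the spectrum lies in [0, 2 t]. In
    this form positivity avoids spectra and passes at once to sums and positive multiples. *)
Definition pos (a : U) : Prop := st a = a /\ exists t, bd t (rs t - a).

Lemma pos_st a : pos a -> st a = a. Proof. by case. Qed.

Lemma pos_rs t : 0 <= t -> pos (rs t).
Proof.
move=> t0; split; first exact: (st_rs H).
by exists t; rewrite subrr; apply: (bd_le H) bd00.
Qed.

Lemma pos0 : pos 0.
Proof. by have := pos_rs (lexx 0); rewrite rmorph0. Qed.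

Lemma posD a b : pos a -> pos b -> pos (a + b).
Proof.
move=> [sa [s hs]] [sb [t ht]]; split; first by rewrite stD sa sb.
by exists (s + t); rewrite rmorphD opprD addrACA; exact: (bdD H).
Qed.

Lemma posZ s a : 0 <= s -> pos a -> pos (rs s * a).
Proof.
move=> s0 [sa [t ht]]; split; first by rewrite stM (st_rs H) sa (rsC H).
exists (s * t); rewrite rmorphM -mulrBr.
by have := bd_rsM s ht; rewrite ger0_norm.
Qed.

Lemma rsV s : s != 0 -> rs s * rs s^-1 = 1.
Proof. by move=> s0; rewrite -rmorphM mulfV // rmorph1. Qed.

(** With z = 1 - a / t the hypothesis reads ||z|| <= 1, and a = t (1 - z), so the root is sqrt t (1
    - v). It is positive because ||v|| <= 1 puts it within sqrt t of sqrt t. *)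
Lemma pos_sqrt a : pos a -> exists b, [/\ st b = b, b * b = a, pos b &
  forall y, y * a = a * y -> y * b = b * y].
Proof.
move=> [sa [t ht]]; have := bd_ge0 H ht; rewrite le_eqVlt => /predU1P[t0|t0].
  move: ht; rewrite -t0 rmorph0 sub0r => /bdN/(bd0 H); rewrite opprK => ->.
  exists 0; split=> [||| y _]; [exact: st0|by rewrite mul0r|exact: pos0|by rewrite mul0r mulr0].
have [||v [sv v1 hv cv]] := @sqrt_one_minus (1 - rs t^-1 * a).
- by rewrite stB st1 stM (st_rs H) sa (rsC H).
- have := bd_rsM t^-1 ht; rewrite ger0_norm ?invr_ge0 ?ltW // mulVf ?gt_eqF //.
  by rewrite mulrBr (rsC H) rsV ?gt_eqF.
have E : rs t * (1 - (1 - rs t^-1 * a)) = a.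
  by rewrite opprB subrKC mulrA rsV ?gt_eqF ?mul1r.
exists (rs (Num.sqrt t) * (1 - v)); split.
- by rewrite stM stB st1 (st_rs H) sv (rsC H).
- by rewrite rsMM hv -expr2 sqr_sqrtr // ltW.
- split; first by rewrite stM stB st1 (st_rs H) sv (rsC H).
  exists (Num.sqrt t); rewrite mulrBr mulr1 opprB subrKC.
  by have := bd_rsM (Num.sqrt t) v1; rewrite ger0_norm ?sqrtr_ge0 // mulr1.
- move=> y ya; have yv : y * v = v * y.
    apply: cv; rewrite mulrBr mulrBl mulr1 mul1r mulrA -(rsC H) -!mulrA.
    by rewrite ya.
  by rewrite mulrA -(rsC H) -!mulrA mulrBr mulrBl mulr1 mul1r yv.
Qed.

Lemma posM_comm a b : pos a -> pos b -> a * b = b * a ->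
  exists c, st c = c /\ a * b = c * c.
Proof.
move=> /pos_sqrt[c [sc <- _ cc]] /pos_sqrt[d [sd <- _ cd]] ab.
have cdd : c * (d * d) = d * d * c by rewrite cc.
have := cd _ cdd => E; exists (c * d); split; first by rewrite stM sd sc E.
by rewrite -!mulrA; congr (_ * _); rewrite !mulrA E.
Qed.

Lemma pos_bd t a : st a = a -> bd t a -> pos (rs t - a).
Proof.
move=> sa ht; split; first by rewrite stB (st_rs H) sa.
by exists t; rewrite opprB subrKC.
Qed.

(** The lemmas above are applied to matrices over the unitization as well; those below, which rest
    on this inequality, to the unitization itself. *)
Hypothesis cstar : forall t x, 0 <= t -> bd (t ^+ 2) (st x * x) -> bd t x.

Lemma st_mul_eq0 x : st x * x = 0 -> x = 0.
Proof.
by move=> x0; apply/(bd0 H)/cstar; rewrite // expr0n x0; exact: bd00.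
Qed.

Lemma sa_sq_eq0 x : st x = x -> x * x = 0 -> x = 0.
Proof. by move=> sx x0; apply: st_mul_eq0; rewrite sx. Qed.

Variable ii : U.
Hypothesis iiC : forall x, ii * x = x * ii.
Hypothesis ii2 : ii * ii = -1.
Hypothesis st_ii : st ii = - ii.

(* [b + i c] and [b - i c] are [sqrt t] times unitaries. *)
Lemma bd_sum_sq t b c : 0 <= t -> st b = b -> st c = c -> b * c = c * b ->
  b * b + c * c = rs t -> bd (Num.sqrt t) b.
Proof.
move=> t0 sb sc bc E.
have tE : Num.sqrt t ^+ 2 = t by rewrite sqr_sqrtr.
have h d : st d = - d -> b * d = d * b -> d * d = - (c * c) ->
    bd (Num.sqrt t) (b + d).
  move=> sd bdd dd; apply: cstar; first exact: sqrtr_ge0.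
  have -> : st (b + d) * (b + d) = b * b + (b * d - d * b) - d * d.
    by rewrite stD sb sd; nc.
  by rewrite bdd subrr addr0 dd opprK E tE; have := bd_rs H t; rewrite ger0_norm.
have sd : st (ii * c) = - (ii * c) by rewrite stM sc st_ii mulrN iiC.
have bdC : b * (ii * c) = ii * c * b by rewrite mulrA -iiC -!mulrA bc.
have dd : ii * c * (ii * c) = - (c * c).
  by rewrite mulrA -(mulrA ii) -iiC mulrA ii2 -!mulrA mulN1r.
have h1 := h _ sd bdC dd.
have h2 : bd (Num.sqrt t) (b - ii * c).
  by apply: h; rewrite ?stN ?sd // ?mulrN ?mulNr ?bdC // dd opprK.
have := bd_rsM 2^-1 (bdD H h1 h2).
have -> : b + ii * c + (b - ii * c) = b + b by nc.
rewrite rs_half; apply: (bd_le H); rewrite ger0_norm ?invr_ge0 //; lra.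
Qed.

(** After scaling to ||b|| <= 1, let u be a root of 1 - b^2 that commutes with b. Then u^2 + b^2 =
    1, so ||u|| <= 1 by [bd_sum_sq], and ||1 - b^2|| = ||u^2|| <= 1. *)
Lemma pos_sq b : st b = b -> pos (b * b).
Proof.
move=> sb; have [s0 hs0] := bd_ex H b; have s00 := bd_ge0 H hs0.
have [s [s_gt0 hs]] : exists s, 0 < s /\ bd s b.
  by exists (s0 + 1); split; [lra|apply: (bd_le H) hs0; lra].
set b' := rs s^-1 * b.
have hb' : bd 1 b'.
  have := bd_rsM s^-1 hs; rewrite ger0_norm ?invr_ge0 ?ltW //.
  by rewrite mulVf ?gt_eqF.
have sb' : st b' = b' by rewrite stM (st_rs H) sb -(rsC H).
have bb1 : bd 1 (b' * b') by have := bdM H hb' hb'; rewrite mulr1.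
have [|v [sv v1 hv cv]] := sqrt_one_minus _ bb1; first by rewrite stM sb'.
have vb : b' * v = v * b' by apply: cv; rewrite mulrA.
have hu : bd 1 (1 - v).
  have := @bd_sum_sq 1 (1 - v) b' ler01; rewrite sqrtr1; apply => //.
  - by rewrite stB st1 sv.
  - by rewrite mulrBl mulrBr mulr1 mul1r vb.
  - by rewrite hv subrK rmorph1.
have -> : b * b = rs (s ^+ 2) * (b' * b').
  rewrite rsMM mulrA -rmorphM.
  have -> : s ^+ 2 * (s^-1 * s^-1) = 1 by field; rewrite gt_eqF.
  by rewrite rmorph1 mul1r.
apply: posZ; first exact: sqr_ge0.
split; first by rewrite stM sb'.
by exists 1; rewrite rmorph1 -hv; have := bdM H hu hu; rewrite mulr1.
Qed.

(** Commuting roots b of a and e of t - a satisfy b^2 + e^2 = t, hence ||b||^2 <= t. *)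
Lemma pos_bd_le t a : 0 <= t -> pos a -> pos (rs t - a) -> bd t a.
Proof.
move=> t0 /pos_sqrt[b [sb ba _ cb]] /pos_sqrt[e [se ee _ ce]].
have bt : b * (rs t - a) = (rs t - a) * b.
  by rewrite mulrBl mulrBr -ba mulrA (rsC H).
have be := ce _ bt.
have := bd_sum_sq t0 sb se be; rewrite ba ee subrKC => /(_ erefl) h.
by have := bdM H h h; rewrite -expr2 sqr_sqrtr // ba.
Qed.

(** The radius hidden in [pos a'] may grow as a' tends to a. Since 0 <= a' <= t + 1, [pos_bd_le]
    replaces it by the fixed radius t + 1. *)
Lemma pos_closed a :
  (forall e, 0 < e -> exists2 a', pos a' & bd e (a - a')) -> pos a.
Proof.
move=> h; have sa : st a = a.
  apply/subr0_eq/bd_eq0 => e e0.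
  have [a' [sa' _] ha'] := h _ (divr_gt0 e0 (ltr0n _ 2)).
  have := bdB (bd_st H ha') ha'; rewrite -splitr stB sa'.
  by have -> : st a - a' - (a - a') = st a - a by nc.
split=> //; have [t ht] := bd_ex H a; have t0 := bd_ge0 H ht.
exists (t + 1); apply: (bd_eps H) => e e0.
have [|a' pa' ha'] := h (Num.min e 1); first by rewrite lt_min e0 ltr01.
have h1 : bd (t + 1) a'.
  have := bdB ht ha'; rewrite opprB subrKC; apply: (bd_le H).
  by rewrite lerD2l ge_min lexx orbT.
have h2 : bd (t + 1) (rs (t + 1) - a').
  apply: pos_bd_le; [lra|apply: pos_bd => //; exact: pos_st|].
  by rewrite opprB subrKC.
have := bdB h2 ha'.
have -> : rs (t + 1) - a' - (a - a') = rs (t + 1) - a by nc.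
apply: (bd_le H).
by rewrite lerD2l ge_min lexx.
Qed.

Lemma posM a b : pos a -> pos b -> a * b = b * a -> pos (a * b).
Proof. by move=> pa pb /(posM_comm pa pb)[c [sc ->]]; exact: pos_sq. Qed.

(** Replaces the comparison of the spectra of [st x * x] and [x * st x]. Let ||x|| <= 1, c = - st x
    * x >= 0 and e = x * st x. The real and imaginary parts of x show e >= 0, so ||1 - e|| <= 1.
    Moving [st x] across gives (1 + c)^n c = - st x (1 - e)^n x, of norm at most 1 for every n,
    whereas it dominates c + n c^2. Hence c^2 = 0. *)
Lemma neg_mul_st y : pos (- (st y * y)) -> y = 0.
Proof.
move=> py; have [s0 hs0] := bd_ex H y; have s00 := bd_ge0 H hs0.
have [s [s_gt0 hs]] : exists s, 0 < s /\ bd s y.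
  by exists (s0 + 1); split; [lra|apply: (bd_le H) hs0; lra].
have yE : y = rs s * (rs s^-1 * y) by rewrite mulrA rsV ?gt_eqF ?mul1r.
suff h x : bd 1 x -> pos (- (st x * x)) -> x = 0.
  rewrite yE (h (rs s^-1 * y)) ?mulr0 //.
    have := bd_rsM s^-1 hs; rewrite ger0_norm ?invr_ge0 ?ltW //.
    by rewrite mulVf ?gt_eqF.
  rewrite stM (st_rs H) -(rsC H) rsMM -mulrN; apply: posZ py.
  by rewrite -expr2 sqr_ge0.
move=> {y py s0 hs0 s00 s s_gt0 hs yE} x1 pc; set c := - (st x * x) in pc.
have sc := pos_st pc.
set p := x + st x; set q := ii * (x - st x).
have sp : st p = p by rewrite stD stK addrC.
have sq : st q = q by rewrite stM stB stK st_ii mulrN -iiC -mulrN opprB.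
set e := x * st x.
have pe : pos e.
  have -> : e = rs 2^-1 * (p * p + q * q) + c.
    rewrite -[LHS]rs_half -[c]rs_half -[RHS]mulrDr; congr (_ * _).
    have -> : q * q = - ((x - st x) * (x - st x)).
      by rewrite /q mulrA -(mulrA ii) -iiC mulrA ii2 -!mulrA mulN1r.
    rewrite /p /e /c; nc.
  by apply: posD => //; apply: posZ; rewrite ?invr_ge0 //; apply: posD; exact: pos_sq.
have e1 : bd 1 (1 - e).
  apply: pos_bd_le => //.
    rewrite -(rmorph1 rs); apply: pos_bd; first exact: pos_st.
    by have := bdM H x1 (bd_st H x1); rewrite mulr1.
  by rewrite rmorph1 opprB subrKC.
have powE n : st x * (1 - e) ^+ n = (1 + c) ^+ n * st x.
  elim: n => [|n IH]; first by rewrite !expr0 mul1r mulr1.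
  by rewrite exprSr mulrA IH exprSr -!mulrA; congr (_ * _); rewrite /e /c; nc.
have bdn n : bd 1 ((1 + c) ^+ n * c).
  have -> : (1 + c) ^+ n * c = - (st x * (1 - e) ^+ n * x).
    by rewrite powE -mulrA -mulrN.
  apply: bdN; rewrite -(mul1r 1); apply: (bdM H) => //.
  rewrite -(mul1r 1); apply: (bdM H); first exact: (bd_st H).
  elim: n => [|n IH]; first exact: bd1.
  by rewrite exprS -(mul1r 1); apply: (bdM H).
(* The remainder in Bernoulli's inequality; [ES] exhibits it as a sum of products of commuting
   positive elements. *)
pose E n := (1 + c) ^+ n * c - c - rs n%:R * (c * c).
have commE n : E n * c = c * E n.
  have h1 : (1 + c) ^+ n * c = c * (1 + c) ^+ n.
    by apply/esym/commrX; rewrite /GRing.comm; nc.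
  rewrite /E 2!mulrBl 2!mulrBr; congr (_ - _ - _); first by rewrite mulrA -h1.
  by rewrite [RHS]mulrA -(rsC H) -!mulrA.
have ES n : E n.+1 = E n + (c * E n + rs n%:R * (c * (c * c))).
  rewrite /E exprS mulrSr rmorphD rmorph1 -[RHS]addrA.
  have -> : rs n%:R * (c * (c * c)) = c * (rs n%:R * (c * c)).
    by rewrite [RHS]mulrA -(rsC H) !mulrA.
  by nc.
have pcc : pos (c * c) by exact: pos_sq.
have pE n : pos (E n).
  elim: n => [|n IH].
    by rewrite /E expr0 mul1r subrr rmorph0 mul0r subr0; exact: pos0.
  rewrite ES; apply: posD => //; apply: posD; first exact: posM.
  by apply: posZ => //; apply: posM; rewrite // mulrA.
have cc0 : c * c = 0.
  apply: bd_eq0 => d d0; pose n := (Num.Def.archi_bound d^-1).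
  have nd : d^-1 < n%:R by apply: archi_boundP; rewrite invr_ge0 ltW.
  have n0 : 0 < n%:R :> R by apply: lt_trans nd; rewrite invr_gt0.
  have : bd 1 (rs n%:R * (c * c)).
    apply: pos_bd_le => //; first exact: posZ.
    have -> : rs 1 - rs n%:R * (c * c) = (rs 1 - (1 + c) ^+ n * c) + (c + E n).
      by rewrite /E; nc.
    apply: posD; last exact: posD.
    apply: pos_bd => //; rewrite stM sc.
    have -> : st ((1 + c) ^+ n) = (1 + c) ^+ n.
      elim: n {nd n0} => [|n IH]; first by rewrite expr0 st1.
      by rewrite exprS stM IH stD st1 sc -exprSr exprS.
    by apply: commrX; rewrite /GRing.comm; nc.
  move/(bd_rsM n%:R^-1); rewrite mulrA -rmorphM mulVf ?gt_eqF // rmorph1 mul1r.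
  apply: (bd_le H); rewrite mulr1 ger0_norm ?invr_ge0 // ltW //.
  by rewrite invf_plt // posrE.
apply: st_mul_eq0; apply: oppr_inj; rewrite oppr0 -/c.
exact: sa_sq_eq0.
Qed.

(* Kaplansky: writing [a = st x * x = m - q] with [m = |a|], the element
   [y = x q] satisfies [st y * y = - q ^ 3 / 2 <= 0]. *)
Lemma pos_mul_st x : pos (st x * x).
Proof.
set a := st x * x; have sa : st a = a by rewrite stM stK.
have [m [sm mm pm cm]] := pos_sqrt (pos_sq sa).
have am : a * m = m * a by apply: cm; rewrite mulrA.
pose q := m - a; pose p := m + a.
have qp0 : q * p = 0.
  have -> : q * p = m * m - a * a + (m * a - a * m) by rewrite /q /p; nc.
  by rewrite mm am !subrr addr0.
have sq : st q = q by rewrite stB sm sa.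
have qm : q * m = m * q by rewrite /q mulrBl mulrBr am.
have [n [sn nn _ cn]] := pos_sqrt pm.
have qn : q * n = n * q by apply: cn; rewrite qm.
(* By [qp0], q a = - q m, hence q^2 = 2 q m and q^3 = 2 q m q = 2 (n q)^2, while
   [st (x * q) * (x * q)] is q a q = - q m q. *)
have qqq : q * q * q = (n * q) * (n * q) + (n * q) * (n * q).
  have -> : n * q * (n * q) = q * m * q by rewrite -nn -qn -!mulrA qn.
  by rewrite -[LHS]addr0 -[0 in LHS](mul0r q) -qp0 /q /p; nc.
have p3 : pos (q * q * q).
  by rewrite qqq; apply: posD; apply: pos_sq; rewrite stM sq sn qn.
have yy : st (x * q) * (x * q) + st (x * q) * (x * q) = - (q * q * q).
  have -> : st (x * q) * (x * q) = q * a * q.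
    by rewrite stM sq /a !mulrA.
  by rewrite -[RHS]addr0 -[0 in RHS](mul0r q) -qp0 /q /p; nc.
have xq0 : x * q = 0.
  apply: neg_mul_st; rewrite -[X in - X]rs_half yy mulrN opprK.
  by apply: posZ; rewrite // invr_ge0.
have q30 : q * q * q = 0.
  by apply: oppr_inj; rewrite oppr0 -yy xq0 mulr0 addr0.
have q0 : q = 0.
  apply: sa_sq_eq0 => //; apply: sa_sq_eq0; first by rewrite stM sq.
  by rewrite mulrA q30 mul0r.
by have -> : a = m by apply/eqP; rewrite eq_sym -subr_eq0; apply/eqP.
Qed.

Lemma pos_conj x a : pos a -> pos (st x * a * x).
Proof.
move=> /pos_sqrt[b [sb <- _ _]].
by rewrite -{1}sb !mulrA -stM -mulrA; exact: pos_mul_st.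
Qed.

End StarBall.

(** * Moduli and norms with values in the reals *)

Definition cR (R : realType) : R -> Cplx R := real_complex R.
HB.instance Definition _ (R : realType) := GRing.RMorphism.on (@cR R).

Definition cmod (R : realType) (z : Cplx R) : R := complex.Re `|z|.

Section Modulus.
Variable R : realType.
Implicit Types (z w : Cplx R) (x y : R).

Lemma normE z : `|z| = cR (cmod z).
Proof. by rewrite /cR /cmod RRe_real // normr_real. Qed.

Lemma cR_le x y : (cR x <= cR y) = (x <= y). Proof. exact: lecR. Qed.
Lemma cR_lt x y : (cR x < cR y) = (x < y). Proof. exact: ltcR. Qed.
Lemma cR_gt0 x : (0 < cR x) = (0 < x). Proof. exact: ltcR. Qed.
Lemma cR_ge0 x : (0 <= cR x) = (0 <= x). Proof. exact: lecR. Qed.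
Lemma cR_inj : injective (@cR R). Proof. exact: complexI. Qed.

Lemma cplx_gt0 z : 0 < z -> exists2 x, 0 < x & z = cR x.
Proof.
move=> z0; exists (complex.Re z); first by move: z0; rewrite ltcE => /andP[].
by rewrite /cR RRe_real // gtr0_real.
Qed.

Lemma cmod_ge0 z : 0 <= cmod z.
Proof. by rewrite -cR_le -normE rmorph0. Qed.

Lemma cmodM z w : cmod (z * w) = cmod z * cmod w.
Proof. by apply: cR_inj; rewrite rmorphM /= -!normE normrM. Qed.

Lemma cmodD z w : cmod (z + w) <= cmod z + cmod w.
Proof. by rewrite -cR_le rmorphD /= -!normE ler_normD. Qed.

Lemma cmod0 : cmod (0 : Cplx R) = 0.
Proof. by rewrite /cmod normr0. Qed.

Lemma cmod_eq0 z : cmod z = 0 -> z = 0.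
Proof. by move=> z0; apply/eqP; rewrite -normr_eq0 normE z0 rmorph0. Qed.

Lemma cmod_conj z : cmod z^* = cmod z.
Proof. by rewrite /cmod norm_conjC. Qed.

Lemma cmod_cR x : cmod (cR x) = `|x|.
Proof.
by rewrite /cmod normc_def /= expr0n addr0 sqrtr_sqr.
Qed.

Lemma cmod_sq z : cmod z ^+ 2 = complex.Re z ^+ 2 + complex.Im z ^+ 2.
Proof. by apply: cR_inj; rewrite rmorphXn /= -normE -add_Re2_Im2. Qed.

Lemma Re_le_cmod z : `|complex.Re z| <= cmod z.
Proof.
rewrite -(ler_pXn2r (ltn0Sn 1)) ?nnegrE ?cmod_ge0 // cmod_sq real_normK ?num_real //.
by rewrite lerDl sqr_ge0.
Qed.

Lemma Im_le_cmod z : `|complex.Im z| <= cmod z.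
Proof.
rewrite -(ler_pXn2r (ltn0Sn 1)) ?nnegrE ?cmod_ge0 // cmod_sq real_normK ?num_real //.
by rewrite lerDr sqr_ge0.
Qed.

Lemma cmod_le_ReIm z : cmod z <= `|complex.Re z| + `|complex.Im z|.
Proof.
rewrite -(ler_pXn2r (ltn0Sn 1)) ?nnegrE ?cmod_ge0 ?addr_ge0 // cmod_sq.
rewrite -(real_normK (num_real (complex.Re z))).
rewrite -(real_normK (num_real (complex.Im z))).
have := normr_ge0 (complex.Re z); have := normr_ge0 (complex.Im z).
by move: `|complex.Re z| `|complex.Im z| => a b a0 b0; nra.
Qed.

End Modulus.

Section RealNorm.
Variables (R : realType) (A : cstarAlgType R).
Implicit Types x y : A.

Lemma rnormE x : `|x| = cR (rnorm x).
Proof. by rewrite /cR /rnorm RRe_real // normr_real. Qed.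

Lemma rnorm_ge0 x : 0 <= rnorm x.
Proof. by rewrite -cR_le -rnormE rmorph0. Qed.

Lemma rnormD x y : rnorm (x + y) <= rnorm x + rnorm y.
Proof. by rewrite -cR_le rmorphD /= -!rnormE ler_normD. Qed.

Lemma rnormN x : rnorm (- x) = rnorm x.
Proof. by rewrite /rnorm normrN. Qed.

Lemma rnormB x y : rnorm (x - y) <= rnorm x + rnorm y.
Proof. by rewrite -(rnormN y) rnormD. Qed.

Lemma rnorm0 : rnorm (0 : A) = 0.
Proof. by rewrite /rnorm normr0. Qed.

Lemma rnorm_eq0 x : rnorm x = 0 -> x = 0.
Proof. by move=> x0; apply/eqP; rewrite -normr_eq0 rnormE x0 rmorph0. Qed.

Lemma rnormZ (a : Cplx R) x : rnorm (a *: x) = cmod a * rnorm x.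
Proof. by apply: cR_inj; rewrite rmorphM /= -normE -!rnormE normrZ. Qed.

Lemma rnormM x y : rnorm (cmul x y) <= rnorm x * rnorm y.
Proof. by rewrite -cR_le rmorphM /= -!rnormE cnormM. Qed.

Lemma rnorm_star_mul x : rnorm (cmul (cstar x) x) = rnorm x ^+ 2.
Proof. by apply: cR_inj; rewrite rmorphXn /= -!rnormE cnorm_star_mul. Qed.

Lemma rnorm_star x : rnorm (cstar x) = rnorm x.
Proof.
have h y : rnorm y <= rnorm (cstar y).
  have := rnorm_ge0 y; rewrite le_eqVlt => /predU1P[<-|y0]; first exact: rnorm_ge0.
  by rewrite -(ler_pM2r y0) -expr2 -rnorm_star_mul rnormM.
by apply/le_anti/andP; split=> //; rewrite -{2}(cstarK x).
Qed.

Lemma cmul0l x : cmul 0 x = 0.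
Proof. by have := cmulZl 0 (0 : A) x; rewrite !scale0r. Qed.
Lemma cmul0r x : cmul x 0 = 0.
Proof. by have := cmulZr 0 x (0 : A); rewrite !scale0r. Qed.
Lemma cmulNl x y : cmul (- x) y = - cmul x y.
Proof. by rewrite -scaleN1r cmulZl scaleN1r. Qed.
Lemma cmulNr x y : cmul x (- y) = - cmul x y.
Proof. by rewrite -scaleN1r cmulZr scaleN1r. Qed.
Lemma cmulBl x y z : cmul (x - y) z = cmul x z - cmul y z.
Proof. by rewrite cmulDl cmulNl. Qed.
Lemma cmulBr x y z : cmul x (y - z) = cmul x y - cmul x z.
Proof. by rewrite cmulDr cmulNr. Qed.
Lemma cstar0 : cstar (0 : A) = 0.
Proof. by have := cstarZ 0 (0 : A); rewrite rmorph0 !scale0r. Qed.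
Lemma cstarN x : cstar (- x) = - cstar x.
Proof. by rewrite -scaleN1r cstarZ rmorphN rmorph1 scaleN1r. Qed.
Lemma cstarB x y : cstar (x - y) = cstar x - cstar y.
Proof. by rewrite cstarD cstarN. Qed.

Lemma rnorm_complete (x : nat -> A) :
  (forall e, 0 < e -> exists K, forall m n, (K <= m)%N -> (K <= n)%N ->
     rnorm (x m - x n) <= e) ->
  exists l, forall e, 0 < e -> exists K, forall k, (K <= k)%N -> rnorm (l - x k) <= e.
Proof.
move=> h; have : cvg (x @ \oo).
  apply/cauchy_cvgP/cauchyP => /= e e0.
  have [e' e'0 ->] := cplx_gt0 e0.
  have [K hK] := h _ (divr_gt0 e'0 (ltr0n _ 2)).
  exists (x K); exists K => // k /= Kk.
  rewrite -ball_normE /= rnormE cR_lt; apply: le_lt_trans (hK _ _ (leqnn _) Kk) _.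
  by rewrite ltr_pdivrMr // ltr_pMr // ltr1n.
move=> /cvg_ex[l /= hl]; exists l => e e0.
have e0' : 0 < cR e by rewrite cR_gt0.
have /cvgrPdist_le /(_ _ e0') [K _ hK] := hl.
by exists K => k /hK; rewrite /= rnormE cR_le.
Qed.

End RealNorm.

Lemma monotone_cauchy (R : realType) (r : nat -> R) M :
  (forall k, r k <= r k.+1) -> (forall k, r k <= M) ->
  forall e, 0 < e -> exists K, forall m n, (K <= m)%N -> (K <= n)%N -> r m - r n <= e.
Proof.
move=> rS rM e e0; have rmono : {homo r : m n / (m <= n)%N >-> m <= n}.
  by apply: homo_leq => // y x z; exact: le_trans.
have hs : has_sup (range r).
  by split; [exists (r 0%N); exists 0%N|exists M => _ [k _ <-]].
have [_ [K _ <-] hK] := sup_adherent e0 hs.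
exists K => m n Km Kn; have h1 := rmono _ _ Kn.
have h2 : r m <= sup (range r) by apply: sup_upper_bound => //; exists m.
lra.
Qed.

(** Completeness in the form of [bd_complete]: steps dominated by the increments of a bounded real
    sequence, which is what the square root iteration provides. *)
Lemma rnorm_telescope_complete (R : realType) (A : cstarAlgType R)
    (x : nat -> A) (r : nat -> R) M :
  (forall k, r k <= M) -> (forall k, rnorm (x k.+1 - x k) <= r k.+1 - r k) ->
  exists l, forall e, 0 < e -> exists K, forall k, (K <= k)%N -> rnorm (l - x k) <= e.
Proof.
move=> rM hx; have rS k : r k <= r k.+1.
  by rewrite -subr_ge0; exact: le_trans (rnorm_ge0 _) (hx k).
have step k d : rnorm (x (k + d)%N - x k) <= r (k + d)%N - r k.
  elim: d => [|d IH]; first by rewrite addn0 !subrr rnorm0.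
  rewrite addnS -(subrKA (x (k + d)%N)); apply: le_trans (rnormD _ _) _.
  by have := hx (k + d)%N; lra.
apply: rnorm_complete => e e0; have [K hK] := monotone_cauchy rS rM e0.
exists K => m n Km Kn.
have [mn|nm] := leqP m n.
  rewrite -opprB rnormN -(subnKC mn); apply: le_trans (step _ _) _.
  by rewrite subnKC //; exact: hK.
rewrite -(subnKC (ltnW nm)); apply: le_trans (step _ _) _.
by rewrite subnKC 1?ltnW //; exact: hK.
Qed.

(** * The unitization *)

Lemma monotone_limit (R : realType) (r : nat -> R) M :
  (forall k, r k <= r k.+1) -> (forall k, r k <= M) ->
  exists l, forall e, 0 < e -> exists K, forall k, (K <= k)%N -> `|l - r k| <= e.
Proof.
move=> rS rM; exists (sup (range r)) => e e0.
have rmono : {homo r : m n / (m <= n)%N >-> m <= n}.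
  by apply: homo_leq => // y x z; exact: le_trans.
have hs : has_sup (range r).
  by split; [exists (r 0%N); exists 0%N|exists M => _ [k _ <-]].
have [_ [K _ <-] hK] := sup_adherent e0 hs.
exists K => k Kk; have h1 := rmono _ _ Kk.
have h2 : r k <= sup (range r) by apply: sup_upper_bound => //; exists k.
by rewrite ger0_norm; lra.
Qed.

(** x is the difference of x + r and r, both nondecreasing; x + r is bounded above because x - r is
    nonincreasing. *)
Lemma real_telescope_complete (R : realType) (x r : nat -> R) M :
  (forall k, r k <= M) -> (forall k, `|x k.+1 - x k| <= r k.+1 - r k) ->
  exists l, forall e, 0 < e -> exists K, forall k, (K <= k)%N -> `|l - x k| <= e.
Proof.
move=> rM hx.
have hx' k : - (r k.+1 - r k) <= x k.+1 - x k <= r k.+1 - r k by rewrite -ler_norml.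
have rS k : r k <= r k.+1 by case/andP: (hx' k); lra.
have yS k : x k + r k <= x k.+1 + r k.+1 by case/andP: (hx' k); lra.
have yM k : x k + r k <= x 0%N - r 0%N + 2 * M.
  have : x k - r k <= x 0%N - r 0%N.
    by elim: k => [//|k]; case/andP: (hx' k); lra.
  by have := rM k; lra.
have [l1 h1] := monotone_limit yS yM; have [l2 h2] := monotone_limit rS rM.
exists (l1 - l2) => e e0; have e2 := divr_gt0 e0 (ltr0n R 2).
have [K1 {}h1] := h1 _ e2; have [K2 {}h2] := h2 _ e2.
exists (maxn K1 K2) => k; rewrite geq_max => /andP[/h1 k1 /h2 k2].
have -> : l1 - l2 - x k = (l1 - (x k + r k)) - (l2 - r k) by ring.
by apply: le_trans (ler_normB _ _) _; rewrite (splitr e) lerD.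
Qed.

Definition unitz (R : realType) (A : cstarAlgType R) : Type := (Cplx R * A)%type.

Section Unitization.
Variables (R : realType) (A : cstarAlgType R).
Local Notation C := (Cplx R).
Local Notation U := (unitz A).

HB.instance Definition _ := GRing.Zmodule.copy U (C * A)%type.

Definition umul (x y : U) : U :=
  (x.1 * y.1, x.1 *: y.2 + y.1 *: x.2 + cmul x.2 y.2).

Lemma unitzP (x y : U) : x.1 = y.1 -> x.2 = y.2 -> x = y.
Proof. by case: x y => [a x] [b y] /= -> ->. Qed.

Lemma unitzD1 (x y : U) : (x + y).1 = x.1 + y.1. Proof. by []. Qed.
Lemma unitzD2 (x y : U) : (x + y).2 = x.2 + y.2. Proof. by []. Qed.
Lemma unitzN1 (x : U) : (- x).1 = - x.1. Proof. by []. Qed.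
Lemma unitzN2 (x : U) : (- x).2 = - x.2. Proof. by []. Qed.

Lemma umulA : associative umul.
Proof.
move=> [a x] [b y] [c z]; apply: unitzP => /=; first by rewrite mulrA.
rewrite !scalerDr !scalerA !cmulDl !cmulDr !cmulZl !cmulZr cmulA !addrA.
rewrite (mulrC c a) (mulrC c b).
by rewrite [LHS](ACl (1*2*4*6*3*5*7)).
Qed.

Lemma umul1l : left_id ((1, 0) : U) umul.
Proof.
by move=> [a x]; apply: unitzP => /=; rewrite ?mul1r // scaler0 addr0 scale1r cmul0l addr0.
Qed.

Lemma umul1r : right_id ((1, 0) : U) umul.
Proof.
by move=> [a x]; apply: unitzP => /=; rewrite ?mulr1 // scaler0 add0r scale1r cmul0r addr0.
Qed.

Lemma umulDl : left_distributive umul +%R.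
Proof.
move=> [a x] [b y] [c z]; apply: unitzP => /=; first by rewrite mulrDl.
by rewrite scalerDl scalerDr cmulDl !addrA [LHS](ACl (1*3*5*2*4*6)).
Qed.

Lemma umulDr : right_distributive umul +%R.
Proof.
move=> [a x] [b y] [c z]; apply: unitzP => /=; first by rewrite mulrDr.
by rewrite scalerDl scalerDr cmulDr !addrA [LHS](ACl (1*3*5*2*4*6)).
Qed.

HB.instance Definition _ := GRing.Zmodule_isPzRing.Build U
  umulA umul1l umul1r umulDl umulDr.

Lemma unitzM1 (x y : U) : (x * y).1 = x.1 * y.1. Proof. by []. Qed.
Lemma unitzM2 (x y : U) :
  (x * y).2 = x.1 *: y.2 + y.1 *: x.2 + cmul x.2 y.2.
Proof. by []. Qed.
Definition uscal (a : C) : U := (a, 0).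

Fact uscal_zmod_morphism : zmod_morphism uscal.
Proof. by move=> a b; apply: unitzP => //; rewrite unitzD2 unitzN2 /= subr0. Qed.
Fact uscal_monoid_morphism : monoid_morphism uscal.
Proof.
split=> // a b; apply: unitzP => //.
by rewrite unitzM2 /= !scaler0 cmul0l !addr0.
Qed.
HB.instance Definition _ := GRing.isZmodMorphism.Build C U uscal uscal_zmod_morphism.
HB.instance Definition _ := GRing.isMonoidMorphism.Build C U uscal uscal_monoid_morphism.

Lemma uscalC a x : uscal a * x = x * uscal a.
Proof.
apply: unitzP; first by rewrite !unitzM1 mulrC.
by rewrite !unitzM2 /= !scaler0 cmul0l cmul0r !addr0 add0r.
Qed.

Definition ureal : R -> U := uscal \o @cR R.
HB.instance Definition _ := GRing.RMorphism.on ureal.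

Definition ustar (x : U) : U := (x.1^*, cstar x.2).

Definition uact (x : U) (c : A) : A := x.1 *: c + cmul x.2 c.

Lemma uactM x y c : uact (x * y) c = uact x (uact y c).
Proof.
rewrite /uact unitzM1 unitzM2 !scalerDr !cmulDl !cmulDr !cmulZl !scalerA.
by rewrite cmulZr cmulA !addrA.
Qed.

Lemma uactD x y c : uact (x + y) c = uact x c + uact y c.
Proof. by rewrite /uact scalerDl cmulDl addrACA. Qed.

Lemma cstar_uact x c d : cmul (cstar (uact x c)) d = cmul (cstar c) (uact (ustar x) d).
Proof.
by rewrite /uact cstarD cstarZ cstarM cmulDl cmulZl cmulDr cmulZr cmulA.
Qed.

(** The C*-norm coming from the action of the unitization on the direct sum of C and A. Left
    multiplication on A alone is not faithful when A has a unit e, as (1, -e) acts by zero; the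
    bound on [x.1] repairs this. *)
Definition ubd (t : R) (x : U) : Prop :=
  cmod x.1 <= t /\ forall c, rnorm (uact x c) <= t * rnorm c.

Lemma ustarK : involutive ustar.
Proof. by move=> [a x]; apply: unitzP => /=; rewrite ?conjCK ?cstarK. Qed.

Lemma ustarD : {morph ustar : x y / x + y}.
Proof. by move=> x y; apply: unitzP => /=; rewrite ?rmorphD ?cstarD. Qed.

Lemma ustarM x y : ustar (x * y) = ustar y * ustar x.
Proof.
apply: unitzP; rewrite ?unitzM1 ?unitzM2 /= ?rmorphM 1?mulrC //.
by rewrite !cstarD !cstarZ cstarM [_ + y.1^* *: _]addrC.
Qed.

Lemma ustar_real a : ustar (ureal a) = ureal a.
Proof.
apply: unitzP => /=; last exact: cstar0.
exact: (conjc_real a).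
Qed.

Lemma ubd_cstar t x : 0 <= t -> ubd (t ^+ 2) (ustar x * x) -> ubd t x.
Proof.
move=> t0 [h1 h2]; split.
  move: h1; rewrite unitzM1 /= cmodM cmod_conj -expr2.
  by rewrite ler_pXn2r ?nnegrE ?cmod_ge0.
move=> c; rewrite -(ler_pXn2r (ltn0Sn 1)) ?nnegrE ?mulr_ge0 ?rnorm_ge0 //.
rewrite -rnorm_star_mul cstar_uact -uactM; apply: le_trans (rnormM _ _) _.
rewrite rnorm_star exprMn [X in _ <= _ * X]expr2 mulrCA.
by apply: ler_wpM2l; rewrite ?rnorm_ge0.
Qed.

Lemma ubd_ge0 t x : ubd t x -> 0 <= t.
Proof. by move=> [h _]; exact: le_trans (cmod_ge0 _) h. Qed.

Lemma ubd_star t x : ubd t x -> ubd t (ustar x).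
Proof.
move=> h; have t0 := ubd_ge0 h; move: h => [h1 h2].
split=> [|c]; first by rewrite cmod_conj.
have := rnorm_ge0 (uact (ustar x) c); rewrite le_eqVlt => /predU1P[<-|p0].
  by rewrite mulr_ge0 ?rnorm_ge0.
rewrite -(ler_pM2r p0) -expr2 -rnorm_star_mul cstar_uact ustarK.
apply: le_trans (rnormM _ _) _.
by rewrite rnorm_star mulrAC [X in _ <= X]mulrC ler_wpM2l ?rnorm_ge0.
Qed.

(** Testing on c = [cstar x.2] gives ||x.2||^2 = ||x c - x.1 c|| <= 2 t ||c||. This control of the
    second coordinate makes the balls definite and complete. *)
Lemma ubd_snd t x : ubd t x -> rnorm x.2 <= 2 * t.
Proof.
move=> [h1 h2]; have := rnorm_ge0 x.2; rewrite le_eqVlt => /predU1P[<-|p0].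
  by rewrite mulr_ge0 // (le_trans (cmod_ge0 _) h1).
have := h2 (cstar x.2); rewrite rnorm_star => h3.
have h4 : rnorm (cmul x.2 (cstar x.2)) = rnorm x.2 ^+ 2.
  by rewrite -{1}(cstarK x.2) rnorm_star_mul rnorm_star.
have h5 : cmul x.2 (cstar x.2) = uact x (cstar x.2) - x.1 *: cstar x.2.
  by rewrite /uact addrC addKr.
rewrite -(ler_pM2r p0) -expr2 -h4 h5; apply: le_trans (rnormB _ _) _.
rewrite rnormZ rnorm_star.
have : cmod x.1 * rnorm x.2 <= t * rnorm x.2 by rewrite ler_pM2r.
lra.
Qed.

Lemma ubd_inj t (a : A) : 0 <= t -> ubd t (0, a) <-> rnorm a <= t.
Proof.
move=> t0; split=> [[_ h]|h].
  have := rnorm_ge0 a; rewrite le_eqVlt => /predU1P[<-//|p0].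
  have := h (cstar a); rewrite /uact /= scale0r add0r rnorm_star.
  by rewrite -{1}(cstarK a) rnorm_star_mul rnorm_star expr2 ler_pM2r.
split=> [|c]; first by rewrite /= cmod0.
rewrite /uact /= scale0r add0r; apply: le_trans (rnormM _ _) _.
by rewrite ler_wpM2r ?rnorm_ge0.
Qed.

Lemma ubdD s t x y : ubd s x -> ubd t y -> ubd (s + t) (x + y).
Proof.
move=> [x1 x2] [y1 y2]; split=> [|c].
  by apply: le_trans (cmodD _ _) _; exact: lerD.
rewrite uactD mulrDl; apply: le_trans (rnormD _ _) _; exact: lerD.
Qed.

Lemma ubd_scal a : ubd (cmod a) (uscal a).
Proof. by split=> [//|c]; rewrite /uact /= cmul0l addr0 rnormZ. Qed.

Lemma Cplx_telescope_complete (x : nat -> C) (r : nat -> R) M :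
  (forall k, r k <= M) -> (forall k, cmod (x k.+1 - x k) <= r k.+1 - r k) ->
  exists l, forall e, 0 < e -> exists K, forall k, (K <= k)%N -> cmod (l - x k) <= e.
Proof.
move=> rM hx.
have [|a ha] := @real_telescope_complete R (fun k => complex.Re (x k)) r M rM.
  move=> k; apply: le_trans (hx k); have := Re_le_cmod (x k.+1 - x k).
  by case: (x k.+1) (x k) => [? ?] [? ?].
have [|b hb] := @real_telescope_complete R (fun k => complex.Im (x k)) r M rM.
  move=> k; apply: le_trans (hx k); have := Im_le_cmod (x k.+1 - x k).
  by case: (x k.+1) (x k) => [? ?] [? ?].
exists (a +i* b)%C => e e0; have e2 := divr_gt0 e0 (ltr0n R 2).
have [K1 {}ha] := ha _ e2; have [K2 {}hb] := hb _ e2.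
exists (maxn K1 K2) => k; rewrite geq_max => /andP[/ha k1 /hb k2].
apply: le_trans (cmod_le_ReIm _) _; rewrite (splitr e).
by move: k1 k2; case: (x k) => [? ?] k1 k2; exact: lerD.
Qed.

Lemma unitz_star_ball : is_star_ball ureal ustar ubd.
Proof.
split.
- move=> a x; exact: uscalC.
- exact: ustarK.
- exact: ustarD.
- exact: ustarM.
- exact: ustar_real.
- exact: ubd_ge0.
- exact: ubdD.
- move=> s t x y hx hy; have s0 := ubd_ge0 hx; have t0 := ubd_ge0 hy.
  case: hx hy => [x1 x2] [y1 y2]; split=> [|c].
    by rewrite unitzM1 cmodM ler_pM ?cmod_ge0.
  rewrite uactM; apply: le_trans (x2 _) _.
  by rewrite -mulrA ler_wpM2l.
- by move=> a; have := ubd_scal (cR a); rewrite cmod_cR.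
- move=> s t x st [x1 x2]; split=> [|c]; first exact: le_trans st.
  by apply: le_trans (x2 _) _; rewrite ler_wpM2r ?rnorm_ge0.
- move=> x; exists (cmod x.1 + rnorm x.2).
  have -> : x = uscal x.1 + ((0, x.2) : U).
    by apply: unitzP; rewrite ?unitzD1 ?unitzD2 /= ?addr0 ?add0r.
  rewrite unitzD1 unitzD2 /= addr0 add0r.
  by apply: ubdD; [exact: ubd_scal|apply/ubd_inj; rewrite ?rnorm_ge0].
- move=> t x h; split=> [|c].
    by apply/ler_addgt0Pr => e /h[].
  have := rnorm_ge0 c; rewrite le_eqVlt => /predU1P[c0|c0].
    by have [_ /(_ c)] := h 1 ltr01; rewrite -c0 !mulr0.
  rewrite -ler_pdivrMr //; apply/ler_addgt0Pr => e /h[_ /(_ c)].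
  by rewrite ler_pdivrMr.
- move=> x h; have := ubd_snd h; case: h => h _; rewrite mulr0 => h2.
  apply: unitzP; first by apply/cmod_eq0/le_anti; rewrite h cmod_ge0.
  by apply/rnorm_eq0/le_anti; rewrite h2 rnorm_ge0.
- exact: ubd_star.
- move=> x r M rM hx.
  have [l1 hl1] : exists l, forall e, 0 < e ->
      exists K, forall k, (K <= k)%N -> cmod (l - (x k).1) <= e.
    by apply: (@Cplx_telescope_complete _ r M) => // k; case: (hx k).
  have [l2 hl2] : exists l, forall e, 0 < e ->
      exists K, forall k, (K <= k)%N -> rnorm (l - (x k).2) <= e.
    apply: (@rnorm_telescope_complete R A _ (fun k => 2 * r k) (2 * M)) => k.
      by have := rM k; lra.
    by have := ubd_snd (hx k); rewrite unitzD2 unitzN2; lra.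
  exists (l1, l2) => e e0; have e2 := divr_gt0 e0 (ltr0n R 2).
  have [K1 h1] := hl1 _ e2; have [K2 h2] := hl2 _ e2.
  exists (maxn K1 K2) => k; rewrite geq_max => /andP[k1 k2].
  have -> : ((l1, l2) : U) - x k = uscal (l1 - (x k).1) + ((0, l2 - (x k).2) : U).
    by apply: unitzP; rewrite ?unitzD1 ?unitzD2 ?unitzN1 ?unitzN2 /= ?addr0 ?add0r.
  rewrite (splitr e); apply: ubdD; last by apply/ubd_inj; [exact: ltW|exact: h2].
  apply: (_ : forall s t x, s <= t -> ubd s x -> ubd t x) (h1 _ k1) (ubd_scal _).
  move=> s t y st [x1 x2]; split=> [|c]; first exact: le_trans st.
  by apply: le_trans (x2 _) _; rewrite ler_wpM2r ?rnorm_ge0.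
Qed.

End Unitization.

Section UnitizationOrder.
Variables (R : realType) (A : cstarAlgType R).
Local Notation C := (Cplx R).
Local Notation U := (unitz A).
Local Notation rs := (@ureal R A).
Local Notation ballU := (unitz_star_ball A).

Definition upos : U -> Prop := pos rs (@ustar R A) (@ubd R A).

Let iiC (x : U) : uscal A ('i : C) * x = x * uscal A 'i.
Proof. exact: uscalC. Qed.

Let ii2 : uscal A ('i : C) * uscal A 'i = -1.
Proof. by rewrite -rmorphM -expr2 sqrCi rmorphN1. Qed.

Let st_ii : ustar (uscal A ('i : C)) = - uscal A 'i.
Proof. by apply: unitzP; rewrite ?unitzN1 ?unitzN2 /= ?conjCi // cstar0 oppr0. Qed.

Lemma upos_star x : upos x -> ustar x = x. Proof. exact: pos_st. Qed.
Lemma upos0 : upos 0. Proof. exact: pos0 ballU. Qed.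
Lemma uposD x y : upos x -> upos y -> upos (x + y). Proof. exact: posD ballU _ _. Qed.
Lemma uposZ t x : 0 <= t -> upos x -> upos (rs t * x).
Proof. exact: posZ ballU _ _. Qed.
Lemma upos_mul x : upos (ustar x * x).
Proof. exact: (pos_mul_st ballU (@ubd_cstar R A) iiC ii2 st_ii x). Qed.
Lemma upos_conj x a : upos a -> upos (ustar x * a * x).
Proof. move=> h; exact: (pos_conj ballU (@ubd_cstar R A) iiC ii2 st_ii x h). Qed.
Lemma upos_sqrt a : upos a -> exists b, ustar b = b /\ b * b = a.
Proof. by move=> /(pos_sqrt ballU)[b [sb bb _ _]]; exists b. Qed.
Lemma upos_ubd t a : ustar a = a -> ubd t a -> upos (rs t - a).
Proof. exact: pos_bd ballU _ _. Qed.
Lemma ubd_upos t a : 0 <= t -> upos a -> upos (rs t - a) -> ubd t a.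
Proof. move=> t0 h1 h2; exact: (pos_bd_le ballU (@ubd_cstar R A) iiC ii2 st_ii t0 h1 h2). Qed.
Lemma upos_closed a :
  (forall e, 0 < e -> exists2 a', upos a' & ubd e (a - a')) -> upos a.
Proof. move=> h; exact: (pos_closed ballU (@ubd_cstar R A) iiC ii2 st_ii h). Qed.
Lemma upos_sum (I : Type) (r : seq I) (F : I -> U) :
  (forall i, upos (F i)) -> upos (\sum_(i <- r) F i).
Proof. by move=> h; elim/big_ind: _ => //; [exact: upos0|exact: uposD]. Qed.
Lemma upos_trans y x z : upos (y - x) -> upos (z - y) -> upos (z - x).
Proof. by move=> h1 h2; rewrite -(subrKA y); exact: uposD. Qed.

End UnitizationOrder.

(** * Matrices over the unitization *)

(** In the unitization, ||a||^2 - [ustar x * x] is c * c with c self-adjoint, and the unital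
    extension F of f maps it to the positive element [ustar (F c) * F c]. So [ustar (F x) * F x] is
    at most ||a||^2, and [ubd_cstar] turns this into a norm bound. *)
Lemma star_hom_contractive (R : realType) (A : cstarAlgType R) (f : A -> A) :
  (forall (a : Cplx R) x y, f (a *: x + y) = a *: f x + f y) ->
  (forall x y, f (cmul x y) = cmul (f x) (f y)) ->
  (forall x, f (cstar x) = cstar (f x)) ->
  forall a, rnorm (f a) <= rnorm a.
Proof.
move=> flin fmul fstar a.
have f0 : f 0 = 0 by apply: (addrI (f 0)); have := flin 1 0 0; rewrite !scale1r !addr0.
have fD x y : f (x + y) = f x + f y by have := flin 1 x y; rewrite !scale1r.
have fZ c x : f (c *: x) = c *: f x by have := flin c x 0; rewrite f0 !addr0.
pose F (x : unitz A) : unitz A := (x.1, f x.2).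
have FM x y : F (x * y) = F x * F y.
  by apply: unitzP; rewrite // /F !unitzM2 /= !fD !fZ fmul.
have FB x y : F (x - y) = F x - F y.
  apply: unitzP => //; change (f (x.2 - y.2) = f x.2 - f y.2).
  by rewrite fD -scaleN1r fZ scaleN1r.
have Fstar x : F (ustar x) = ustar (F x) by apply: unitzP; rewrite //= fstar.
have Freal t : F (ureal A t) = ureal A t by apply: unitzP; rewrite //= f0.
pose x : unitz A := (0, a).
have h1 : ubd (rnorm a) x by apply/ubd_inj; rewrite ?rnorm_ge0.
suff h2 : ubd (rnorm a) (F x) by apply/ubd_inj; rewrite ?rnorm_ge0.
apply: ubd_cstar; first exact: rnorm_ge0.
apply: ubd_upos; [exact: sqr_ge0|exact: upos_mul|].
have sx : ustar (ustar x * x) = ustar x * x by rewrite ustarM ustarK.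
have hx : ubd (rnorm a ^+ 2) (ustar x * x).
  by rewrite expr2; apply: (bdM (unitz_star_ball A)) => //; exact: ubd_star.
have [c [sc cc]] := upos_sqrt (upos_ubd sx hx).
rewrite -Freal -Fstar -FM -FB -cc FM -{1}sc Fstar; exact: upos_mul.
Qed.

Section HilbertModule.
Variables (R : realType) (A : cstarAlgType R).
Local Notation C := (Cplx R).
Local Notation U := (unitz A).
Local Notation rs := (@ureal R A).
Local Notation ballU := (unitz_star_ball A).

Lemma urealC a (x : U) : rs a * x = x * rs a.
Proof. exact: uscalC. Qed.

Lemma ustar0 : ustar (0 : U) = 0. Proof. exact: st0 ballU. Qed.
Lemma ustarN (x : U) : ustar (- x) = - ustar x. Proof. exact: (stN ballU). Qed.
Lemma ustar_sum (I : Type) (r : seq I) (F : I -> U) :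
  ustar (\sum_(i <- r) F i) = \sum_(i <- r) ustar (F i).
Proof. exact: (big_morph _ (@ustarD R A) ustar0). Qed.

Definition vdot n (v w : 'cV[U]_n) : U := \sum_i ustar (v i 0) * w i 0.

Definition mstar m n (X : 'M[U]_(m, n)) : 'M[U]_(n, m) :=
  \matrix_(i, j) ustar (X j i).

Lemma vdotDl n (u v w : 'cV[U]_n) : vdot (u + v) w = vdot u w + vdot v w.
Proof. by rewrite -big_split; apply: eq_bigr => i _; rewrite mxE ustarD mulrDl. Qed.

Lemma vdotDr n (u v w : 'cV[U]_n) : vdot u (v + w) = vdot u v + vdot u w.
Proof. by rewrite -big_split; apply: eq_bigr => i _; rewrite mxE mulrDr. Qed.

Lemma vdotNl n (u v : 'cV[U]_n) : vdot (- u) v = - vdot u v.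
Proof. by rewrite -sumrN; apply: eq_bigr => i _; rewrite mxE ustarN mulNr. Qed.

Lemma vdotNr n (u v : 'cV[U]_n) : vdot u (- v) = - vdot u v.
Proof. by rewrite -sumrN; apply: eq_bigr => i _; rewrite mxE mulrN. Qed.

Lemma vdotZl n a (u v : 'cV[U]_n) : vdot (rs a *: u) v = rs a * vdot u v.
Proof.
rewrite mulr_sumr; apply: eq_bigr => i _.
by rewrite mxE ustarM ustar_real -urealC mulrA.
Qed.

Lemma vdotZr n a (u v : 'cV[U]_n) : vdot u (rs a *: v) = rs a * vdot u v.
Proof.
rewrite mulr_sumr; apply: eq_bigr => i _.
by rewrite mxE mulrA -urealC -mulrA.
Qed.

Lemma vdot_mstar m n (X : 'M[U]_(m, n)) v w :
  vdot (X *m v) w = vdot v (mstar X *m w).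
Proof.
rewrite /vdot; under eq_bigr do rewrite mxE ustar_sum mulr_suml.
rewrite exchange_big; apply: eq_bigr => j _; rewrite mxE mulr_sumr.
by apply: eq_bigr => i _; rewrite mxE ustarM mulrA.
Qed.

Lemma mstarK m n : cancel (@mstar m n) (@mstar n m).
Proof. by move=> X; apply/matrixP => i j; rewrite !mxE ustarK. Qed.

Lemma mstarD m n (X Y : 'M[U]_(m, n)) : mstar (X + Y) = mstar X + mstar Y.
Proof. by apply/matrixP => i j; rewrite !mxE ustarD. Qed.

Lemma mstarM m n p (X : 'M[U]_(m, n)) (Y : 'M[U]_(n, p)) :
  mstar (X *m Y) = mstar Y *m mstar X.
Proof.
apply/matrixP => i j; rewrite !mxE ustar_sum; apply: eq_bigr => k _.
by rewrite !mxE ustarM.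
Qed.

Lemma upos_vdot n (v : 'cV[U]_n) : upos (vdot v v).
Proof. by apply: upos_sum => i; exact: upos_mul. Qed.

Lemma vdot_ge_entry n (v : 'cV[U]_n) i : upos (vdot v v - ustar (v i 0) * v i 0).
Proof.
rewrite /vdot (bigD1 i) //= addrAC subrr add0r.
elim/big_ind : _ => [|x y|j _]; [exact: upos0|exact: uposD|exact: upos_mul].
Qed.

(* The operator inequality [|X v|^2 <= t^2 |v|^2] in place of the norm
   inequality makes the Cauchy-Schwarz inequality unnecessary. *)
Definition bdm n (t : R) (X : 'M[U]_n) : Prop :=
  0 <= t /\ forall v : 'cV[U]_n,
    upos (rs (t ^+ 2) * vdot v v - vdot (X *m v) (X *m v)).

Lemma bdm_le n s t (X : 'M[U]_n) : s <= t -> bdm s X -> bdm t X.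
Proof.
move=> st [s0 h]; split=> [|v]; first exact: le_trans st.
apply: upos_trans (h v) _.
rewrite -mulrBl -rmorphB; apply: uposZ (upos_vdot v).
by rewrite subr_ge0 ler_pXn2r // nnegrE // (le_trans s0).
Qed.

Lemma bdm_eps n t (X : 'M[U]_n) : (forall e, 0 < e -> bdm (t + e) X) -> bdm t X.
Proof.
move=> h; have t0 : 0 <= t.
  by apply/ler_addgt0Pr => e /h[].
split=> // v; apply: upos_closed => e e0.
have [s hs] := bd_ex ballU (vdot v v); have s0 := bd_ge0 ballU hs.
have k0 : 0 < (2 * t + 1) * (s + 1) by rewrite mulr_gt0 //; lra.
(* As d <= 1, (t + d)^2 - t^2 <= (2 t + 1) d; s + 1 in place of s keeps the divisor positive. *)
have [d [d0 d1 de]] : exists d, [/\ 0 < d, d <= 1 & (2 * t + 1) * (s + 1) * d <= e].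
  exists (Num.min 1 (e / ((2 * t + 1) * (s + 1)))); split.
  - by rewrite lt_min ltr01 divr_gt0.
  - by rewrite ge_min lexx.
  - by rewrite mulrC -ler_pdivlMr // ge_min lexx orbT.
exists (rs ((t + d) ^+ 2) * vdot v v - vdot (X *m v) (X *m v)).
  by have [] := h d d0.
rewrite opprB addrA subrK -mulrBl -rmorphB.
apply: (bd_le ballU) (bd_rsM ballU _ hs).
apply: le_trans de; have -> : t ^+ 2 - (t + d) ^+ 2 = - ((2 * t + d) * d) by ring.
rewrite normrN ger0_norm; last by rewrite mulr_ge0; lra.
rewrite mulrAC; apply: ler_wpM2r; first exact: ltW.
by apply: ler_pM; lra.
Qed.

(** With x = X v and y = Y v, |x + y|^2 <= (1 + t / s) |x|^2 + (1 + s / t) |y|^2, the defect being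
    |t x - s y|^2 / (s t). These weights combine s^2 and t^2 into (s + t)^2. Vanishing radii are
    reached through [bdm_eps]. *)
Lemma bdmD n s t (X Y : 'M[U]_n) : bdm s X -> bdm t Y -> bdm (s + t) (X + Y).
Proof.
have pos_case s' t' : 0 < s' -> 0 < t' -> bdm s' X -> bdm t' Y ->
    bdm (s' + t') (X + Y).
  move=> s0 t0 [_ hX] [_ hY]; split=> [|v]; first by rewrite addr_ge0 ?ltW.
  rewrite mulmxDl; set x := X *m v; set y := Y *m v.
  pose w := rs t' *: x - rs s' *: y.
  have st0 : 0 < s' * t' by rewrite mulr_gt0.
  have E : rs ((s' + t') ^+ 2) * vdot v v - vdot (x + y) (x + y) =
    rs ((s' + t') / s') * (rs (s' ^+ 2) * vdot v v - vdot x x) +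
    (rs ((s' + t') / t') * (rs (t' ^+ 2) * vdot v v - vdot y y) +
     rs (s' * t')^-1 * vdot w w).
    have E1 : rs ((s' + t') ^+ 2) = rs ((s' + t') / s') * rs (s' ^+ 2) +
        rs ((s' + t') / t') * rs (t' ^+ 2).
      by rewrite -!rmorphM -rmorphD; congr rs; field; rewrite !gt_eqF.
    have F1 : rs ((s' + t') / s') = 1 + rs (t' / s').
      by rewrite -(rmorph1 rs) -rmorphD; congr rs; field; rewrite gt_eqF.
    have F2 : rs ((s' + t') / t') = 1 + rs (s' / t').
      by rewrite -(rmorph1 rs) -rmorphD; congr rs; field; rewrite gt_eqF.
    have E2 : rs (s' * t')^-1 * vdot w w =
        rs (t' / s') * vdot x x - vdot x y - vdot y x + rs (s' / t') * vdot y y.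
      rewrite /w !(vdotDl, vdotDr, vdotNl, vdotNr, vdotZl, vdotZr).
      rewrite !(mulrDr, mulrN, opprK) !mulrA -!rmorphM.
      have -> : (s' * t')^-1 * t' * t' = t' / s' by field; rewrite !gt_eqF.
      have -> : (s' * t')^-1 * t' * s' = 1 by field; rewrite !gt_eqF.
      have -> : (s' * t')^-1 * s' * s' = s' / t' by field; rewrite !gt_eqF.
      by rewrite rmorph1 !mul1r !addrA.
    rewrite E2 E1 F1 F2 !(vdotDl, vdotDr); nc.
  rewrite E; apply: uposD; last apply: uposD.
  - by apply: uposZ (hX v); rewrite divr_ge0 ?addr_ge0 ?ltW.
  - by apply: uposZ (hY v); rewrite divr_ge0 ?addr_ge0 ?ltW.
  - by apply: uposZ (upos_vdot w); rewrite invr_ge0 ltW.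
move=> hX hY; apply: bdm_eps => e e0.
have -> : s + t + e = (s + e / 2) + (t + e / 2) by field.
have s0 := hX.1; have t0 := hY.1.
by apply: pos_case; [lra|lra|apply: bdm_le hX; lra|apply: bdm_le hY; lra].
Qed.

Lemma bdmM n s t (X Y : 'M[U]_n) : bdm s X -> bdm t Y -> bdm (s * t) (X *m Y).
Proof.
move=> [s0 hX] [t0 hY]; split=> [|v]; first exact: mulr_ge0.
rewrite -mulmxA; apply: upos_trans (hX (Y *m v)) _.
rewrite exprMn rmorphM -mulrA -mulrBr; apply: uposZ (hY v); exact: sqr_ge0.
Qed.

Lemma ubd_entry n t (X : 'M[U]_n) i j : bdm t X -> ubd t (X i j).
Proof.
move=> [t0 h]; have := h (delta_mx j 0).
have -> : vdot (delta_mx j 0) (delta_mx j 0 : 'cV[U]_n) = 1.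
  rewrite /vdot (bigD1 j) //= !mxE !eqxx /= mulr1 (st1 ballU) big1 ?addr0 //.
  by move=> k kj; rewrite !mxE (negPf kj) mulr0.
rewrite mulr1 -colE => h1; apply: ubd_cstar => //.
apply: ubd_upos; [exact: sqr_ge0|exact: upos_mul|].
apply: upos_trans h1; have := vdot_ge_entry (col j X) i.
by rewrite mxE.
Qed.

Lemma bdm_delta n t a (i j : 'I_n) : ubd t a -> bdm t (a *: delta_mx i j).
Proof.
move=> h; have t0 := ubd_ge0 h; split=> // v.
have -> : vdot (a *: delta_mx i j *m v) (a *: delta_mx i j *m v) =
    ustar (v j 0) * (ustar a * a) * v j 0.
  have E : a *: delta_mx i j *m v = \col_k (a * (v j 0 *+ (k == i))).
    apply/matrixP => k l; rewrite !mxE (bigD1 j) //= big1 ?addr0.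
      rewrite !mxE eqxx andbT ord1.
      by case: eqP; rewrite ?mulr1 ?mulr0 ?mul0r ?mulr1n ?mulr0n ?mulr0.
    by move=> m mj; rewrite !mxE (negPf mj) andbF mulr0 mul0r.
  rewrite E /vdot (bigD1 i) //= big1 ?addr0 ?mxE ?eqxx ?mulr1n.
    by rewrite ustarM !mulrA.
  by move=> k ki; rewrite mxE (negPf ki) mulr0n !mulr0.
have h1 : upos (rs (t ^+ 2) * vdot v v - rs (t ^+ 2) * (ustar (v j 0) * v j 0)).
  by rewrite -mulrBr; apply: uposZ (vdot_ge_entry v j); exact: sqr_ge0.
apply: upos_trans h1; rewrite mulrA urealC -mulrA.
rewrite -(mulrA _ _ (v j 0)) -mulrBr.
rewrite -mulrBl mulrA; apply: upos_conj; apply: upos_ubd.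
  by rewrite ustarM ustarK.
by rewrite expr2; apply: (bdM ballU) => //; exact: ubd_star.
Qed.

Lemma bdm0 n : bdm 0 (0 : 'M[U]_n).
Proof.
split=> // v; rewrite mul0mx expr0n rmorph0 mul0r /vdot big1 ?subrr; first exact: upos0.
by move=> i _; rewrite mxE mulr0.
Qed.

Lemma bdm_sum n (I : Type) (r : seq I) (t : I -> R) (X : I -> 'M[U]_n) :
  (forall i, bdm (t i) (X i)) -> bdm (\sum_(i <- r) t i) (\sum_(i <- r) X i).
Proof.
move=> h; elim/big_rec2: _ => [|i x s _ IH]; first exact: bdm0.
exact: bdmD.
Qed.

Lemma bdm_entries n (t : 'I_n -> 'I_n -> R) (X : 'M[U]_n) :
  (forall i j, ubd (t i j) (X i j)) -> bdm (\sum_i \sum_j t i j) X.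
Proof.
move=> h; rewrite [X]matrix_sum_delta; apply: bdm_sum => i; apply: bdm_sum => j.
exact: bdm_delta.
Qed.

Definition mreal n (a : R) : 'M[U]_n := (rs a)%:M.

Fact mreal_zmod_morphism n : zmod_morphism (@mreal n).
Proof. by move=> a b; rewrite /mreal rmorphB raddfB. Qed.
Fact mreal_monoid_morphism n : monoid_morphism (@mreal n).
Proof. by split=> [|a b]; rewrite /mreal ?rmorph1 // rmorphM scalar_mxM. Qed.
HB.instance Definition _ n :=
  GRing.isZmodMorphism.Build R 'M[U]_n (@mreal n) (@mreal_zmod_morphism n).
HB.instance Definition _ n :=
  GRing.isMonoidMorphism.Build R 'M[U]_n (@mreal n) (@mreal_monoid_morphism n).

End HilbertModule.

Section MatrixOrder.
Variables (R : realType) (A : cstarAlgType R) (n : nat).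
Local Notation U := (unitz A).
Local Notation rs := (@ureal R A).
Local Notation ballU := (unitz_star_ball A).

(** Completing the square, for y = [mstar X *m v]: s^2 (s^2 |v|^2 - |y|^2) = |s^2 v - X y|^2 + (s^2
    |y|^2 - |X y|^2). *)
Lemma bdm_mstar t (X : 'M[U]_n) : bdm t X -> bdm t (mstar X).
Proof.
have pos_case s : 0 < s -> bdm s X -> bdm s (mstar X).
  move=> s0 [_ h]; split=> [|v]; first exact: ltW.
  set y := mstar X *m v; pose w := rs (s ^+ 2) *: v - X *m y.
  have E : rs (s ^+ 2) * vdot v v - vdot y y = rs (s ^- 2) *
      (vdot w w + (rs (s ^+ 2) * vdot y y - vdot (X *m y) (X *m y))).
    have E1 : vdot v (X *m y) = vdot y y by rewrite -{1}(mstarK X) -vdot_mstar.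
    have E2 : vdot (X *m y) v = vdot y y by rewrite vdot_mstar.
    rewrite /w !(vdotDl, vdotDr, vdotNl, vdotNr, vdotZl, vdotZr) E1 E2.
    rewrite !(mulrDr, mulrN, opprK) !mulrA -!rmorphM.
    have -> : s ^- 2 * s ^+ 2 = 1 by rewrite mulVf // expf_neq0 ?gt_eqF.
    by rewrite mul1r rmorph1 !mul1r; nc.
  rewrite E; apply: uposZ; first by rewrite invr_ge0 sqr_ge0.
  by apply: uposD => //; exact: upos_vdot.
move=> h; apply: bdm_eps => e e0; have t0 := h.1.
by apply: pos_case; [lra|apply: bdm_le h; lra].
Qed.

Lemma mreal_mul a (X : 'M[U]_n) : mreal A n a * X = rs a *: X.
Proof. exact: mul_scalar_mx. Qed.

Lemma matrix_star_ball : is_star_ball (@mreal R A n) (@mstar R A n n) (@bdm R A n).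
Proof.
split.
- move=> a X; apply/matrixP => i j; rewrite mreal_mul !mxE urealC.
  rewrite (bigD1 j) //= big1 ?addr0; first by rewrite mxE eqxx mulr1n.
  by move=> k kj; rewrite mxE (negPf kj) mulr0n mulr0.
- exact: mstarK.
- exact: mstarD.
- exact: mstarM.
- move=> a; apply/matrixP => i j; rewrite !mxE eq_sym.
  by case: eqP => _; rewrite ?mulr1n ?mulr0n ?ustar_real ?ustar0.
- by move=> t X [].
- by move=> s t X Y; exact: bdmD.
- by move=> s t X Y; exact: bdmM.
- move=> a; split=> // v.
  rewrite mul_scalar_mx vdotZl vdotZr mulrA -rmorphM real_normK ?num_real //.
  by rewrite expr2 subrr; exact: upos0.
- by move=> s t X; exact: bdm_le.
- move=> X; have h i j : exists t, ubd t (X i j) by exact: bd_ex ballU (X i j).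
  pose t i j := projT1 (cid (h i j)).
  by exists (\sum_i \sum_j t i j); apply: bdm_entries => i j; exact: (projT2 (cid (h i j))).
- by move=> t X; exact: bdm_eps.
- move=> X h; apply/matrixP => i j; rewrite mxE; apply: (bd0 ballU).
  exact: ubd_entry.
- by move=> t X; exact: bdm_mstar.
- move=> x r M rM hx.
  have lim i j : exists l, forall e, 0 < e ->
      exists K, forall k, (K <= k)%N -> ubd e (l - x k i j).
    apply: (bd_complete ballU (x := fun k => x k i j) rM) => k.
    by have := ubd_entry i j (hx k); rewrite !mxE.
  pose l i j := projT1 (cid (lim i j)).
  have hl i j : forall e, 0 < e ->
      exists K, forall k, (K <= k)%N -> ubd e (l i j - x k i j).
    exact: (projT2 (cid (lim i j))).
  exists (\matrix_(i, j) l i j) => e e0.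
  (* The n^2 entries contribute d each; the successor keeps the denominator nonzero for n = 0. *)
  pose d := e / (n * n).+1%:R; have d0 : 0 < d by rewrite divr_gt0.
  have hK i j : exists K, forall k, (K <= k)%N -> ubd d (l i j - x k i j).
    exact: hl.
  pose K i j := projT1 (cid (hK i j)).
  exists (\max_i \max_j K i j)%N => k Kk.
  have := @bdm_entries R A n (fun _ _ => d) (\matrix_(i, j) l i j - x k).
  move=> /(_ _)/bdm_le; apply.
    rewrite !sumr_const card_ord -mulrnA -[d *+ _]mulr_natr /d mulrAC ler_pdivrMr //.
    by rewrite ler_pM2l // ler_nat.
  move=> i j; rewrite !mxE; apply: (projT2 (cid (hK i j))); apply: leq_trans Kk; rewrite -/(K i j).
  by apply: leq_trans (leq_bigmax i); apply: leq_bigmax j.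
Qed.

(** The root exists once ||t - H|| <= t, that is, |H v|^2 <= 2 t <v, H v>. [CS] gives this even with
    t in place of 2 t. Its ingredient [form_le] comes from expanding |t u - H u|^2 and using |H u|^2
    <= t^2 |u|^2. *)
Lemma form_pos_sqrt (H : 'M[U]_n) : mstar H = H ->
  (forall v : 'cV[U]_n, upos (vdot v (H *m v))) ->
  exists B, mstar B = B /\ B *m B = H.
Proof.
move=> sH pH; have [t [t0 ht]] : exists t, 0 < t /\ bdm t H.
  have [t ht] := bd_ex matrix_star_ball H; exists (t + 1).
  by have := ht.1; split; [lra|apply: bdm_le ht; lra].
suff h : bdm t (mreal A n t - H).
  have [|B [sB BB _ _]] := @pos_sqrt R _ _ _ _ matrix_star_ball H; last by exists B.
  by split=> //; exists t.
have adj v w : vdot (H *m v) w = vdot v (H *m w) by rewrite vdot_mstar sH.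
have form_le u : upos (rs t * vdot u u - vdot u (H *m u)).
  have E : rs t * vdot u u - vdot u (H *m u) = rs (2 * t)^-1 *
      ((rs (t ^+ 2) * vdot u u - vdot (H *m u) (H *m u)) +
       vdot (rs t *: u - H *m u) (rs t *: u - H *m u)).
    rewrite invfM rmorphM -mulrA -[LHS](rs_half rs); congr (_ * _).
    rewrite !(vdotDl, vdotDr, vdotNl, vdotNr, vdotZl, vdotZr) !adj.
    rewrite !(mulrDr, mulrN, opprK) !mulrA -!rmorphM.
    have -> : t^-1 * t ^+ 2 = t by field; rewrite gt_eqF.
    have -> : t^-1 * t * t = t by field; rewrite gt_eqF.
    have -> : t^-1 * t = 1 by field; rewrite gt_eqF.
    by rewrite rmorph1 !mul1r; nc.
  rewrite E; apply: uposZ; first by rewrite invr_ge0 mulr_ge0 // ltW.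
  by apply: uposD; [exact: ht.2|exact: upos_vdot].
(* Positivity of the form at w = t v - H v is combined with [form_le] at H v; the terms of third
   order in H cancel. *)
have CS v : upos (rs t * vdot v (H *m v) - vdot (H *m v) (H *m v)).
  pose w := rs t *: v - H *m v.
  have E : rs t * vdot v (H *m v) - vdot (H *m v) (H *m v) = rs t^-1 *
     (vdot w (H *m w) + (rs t * vdot (H *m v) (H *m v) -
        vdot (H *m v) (H *m (H *m v)))).
    have -> : H *m w = rs t *: (H *m v) - H *m (H *m v).
      rewrite mulmxBr; congr (_ - _); apply/matrixP => i j.
      rewrite !mxE mulr_sumr; apply: eq_bigr => k _.
      by rewrite !mxE [LHS]mulrA [RHS]mulrA (urealC t (H i k)).
    rewrite /w !(vdotDl, vdotDr, vdotNl, vdotNr, vdotZl, vdotZr) -!adj.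
    rewrite !(mulrDr, mulrN, opprK) !mulrA -!rmorphM mulVf ?gt_eqF //.
    rewrite rmorph1 !mul1r; nc.
  rewrite E; apply: uposZ; first by rewrite invr_ge0 ltW.
  by apply: uposD; [exact: pH|exact: form_le].
split=> [|v]; first exact: ltW.
rewrite mulmxBl mul_scalar_mx.
set y := H *m v.
have -> : rs (t ^+ 2) * vdot v v - vdot (rs t *: v - y) (rs t *: v - y) =
    (rs t * vdot v y - vdot y y) + rs t * vdot v y.
  rewrite !(vdotDl, vdotDr, vdotNl, vdotNr, vdotZl, vdotZr) adj -/y.
  rewrite !(mulrDr, mulrN, opprK) !mulrA -!rmorphM expr2.
  nc.
by apply: uposD; [exact: CS|apply: uposZ => //; exact: ltW].
Qed.

End MatrixOrder.

(** * The algebra and its matrices inside the unitization *)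

Section Embedding.
Variables (R : realType) (A : cstarAlgType R).
Local Notation C := (Cplx R).
Local Notation U := (unitz A).
Local Notation rs := (@ureal R A).
Local Notation ballU := (unitz_star_ball A).

Definition uinj (a : A) : U := (0, a).

Fact uinj_zmod_morphism : zmod_morphism uinj.
Proof. by move=> a b; apply: unitzP => //; rewrite unitzD1 unitzN1 /= subr0. Qed.
HB.instance Definition _ := GRing.isZmodMorphism.Build A U uinj uinj_zmod_morphism.

Lemma uinjM a b : uinj (cmul a b) = uinj a * uinj b.
Proof.
apply: unitzP; rewrite ?unitzM1 ?unitzM2 /= ?mulr0 //.
by rewrite !scale0r !add0r.
Qed.

Lemma ustar_inj a : ustar (uinj a) = uinj (cstar a).
Proof. by apply: unitzP; rewrite //= rmorph0. Qed.

Lemma ureal_inj t a : rs t * uinj a = uinj (cR t *: a).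
Proof.
apply: unitzP; rewrite ?unitzM1 ?unitzM2 /= ?mulr0 //.
by rewrite scale0r cmul0l !addr0.
Qed.

Definition csq n (v : 'cV[A]_n) : A := \sum_i cmul (cstar (v i 0)) (v i 0).

Lemma uinj_csq n (v : 'cV[A]_n) : uinj (csq v) = vdot (map_mx uinj v) (map_mx uinj v).
Proof.
rewrite /csq raddf_sum; apply: eq_bigr => i _ /=.
by rewrite !mxE ustar_inj -uinjM.
Qed.

Lemma csq_le n t (v : 'cV[A]_n) : 0 <= t ->
  rnorm (csq v) <= t <-> upos (rs t - uinj (csq v)).
Proof.
move=> t0; have pv : upos (uinj (csq v)) by rewrite uinj_csq; exact: upos_vdot.
split=> [h|h]; first by apply: upos_ubd; [exact: upos_star|apply/ubd_inj].
by apply/(@ubd_inj R A t) => //; exact: ubd_upos.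
Qed.

Lemma hilbert_norm_le n t (v : 'cV[A]_n) : 0 <= t ->
  (hilbert_norm v <= t) = (rnorm (csq v) <= t ^+ 2).
Proof.
move=> t0; rewrite -[RHS]ler_sqrt ?sqr_ge0 // sqrtr_sqr ger0_norm //.
Qed.

(** The defect from convexity of |.|^2 is c (1 - c) |u - w|^2 >= 0. This stands in for the triangle
    inequality of [hilbert_norm]. *)
Lemma csq_convex n c (u w : 'cV[A]_n) : 0 <= c <= 1 ->
  rnorm (csq u) <= 1 -> rnorm (csq w) <= 1 ->
  rnorm (csq (\col_i (cR c *: u i 0 + cR (1 - c) *: w i 0))) <= 1.
Proof.
move=> /andP[c0 c1] /(csq_le u ler01) hu /(csq_le w ler01) hw.
apply/(csq_le _ ler01); move: hu hw; rewrite !uinj_csq.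
have -> : map_mx uinj (\col_i (cR c *: u i 0 + cR (1 - c) *: w i 0)) =
    rs c *: map_mx uinj u + rs (1 - c) *: map_mx uinj w.
  by apply/matrixP => i j; rewrite !mxE raddfD /= !ureal_inj ord1.
move: (map_mx uinj u) (map_mx uinj w) => x y hx hy.
have -> : rs 1 - vdot (rs c *: x + rs (1 - c) *: y) (rs c *: x + rs (1 - c) *: y) =
   rs c * (rs 1 - vdot x x) + (rs (1 - c) * (rs 1 - vdot y y) +
    rs (c * (1 - c)) * vdot (x - y) (x - y)).
  rewrite !(vdotDl, vdotDr, vdotNl, vdotNr, vdotZl, vdotZr).
  by rewrite !rmorphM !rmorphB !rmorph1 /=; nc.
apply: uposD; first exact: uposZ.
apply: uposD; first by apply: uposZ; rewrite // subr_ge0.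
by apply: uposZ (upos_vdot _); rewrite mulr_ge0 ?subr_ge0.
Qed.

Lemma map_uinjM m n p (X : 'M[A]_(m, n)) (Y : 'M[A]_(n, p)) :
  map_mx uinj (cmulmx X Y) = map_mx uinj X *m map_mx uinj Y.
Proof.
apply/matrixP => i j; rewrite !mxE raddf_sum; apply: eq_bigr => k _.
by rewrite !mxE /= uinjM.
Qed.

Lemma map_uinj_star m n (X : 'M[A]_(m, n)) :
  map_mx uinj (cstarmx X) = mstar (map_mx uinj X).
Proof. by apply/matrixP => i j; rewrite !mxE ustar_inj. Qed.

Lemma map_uinj_inj m n : injective (@map_mx _ _ uinj m n).
Proof.
by move=> X Y /matrixP E; apply/matrixP => i j; have := E i j; rewrite !mxE => -[].
Qed.

(* The square root is found in [M_n] of the unitization; its scalar part is a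
   hermitian complex matrix of square zero, hence zero. *)
Lemma mx_positive_form n (H : 'M[A]_n) : cstarmx H = H ->
  (forall v : 'cV[U]_n, upos (vdot v (map_mx uinj H *m v))) -> mx_positive H.
Proof.
move=> sH pH; have [|B [sB BB]] := form_pos_sqrt _ pH.
  by rewrite -map_uinj_star sH.
have B0 i j : (B i j).1 = 0.
  have stB k l : (B k l).1^* = (B l k).1.
    by rewrite -{2}sB mxE.
  have : (map_mx uinj H j j).1 = 0 by rewrite mxE.
  have fst_sum (F : 'I_n -> U) : (\sum_k F k).1 = \sum_k (F k).1.
    exact: (big_morph (fun x : U => x.1) (@unitzD1 R A)).
  rewrite -BB mxE fst_sum => /psumr_eq0P h.
  have : (B j i * B i j).1 = 0.
    by apply: h => // k _; rewrite unitzM1 -stB mulrC mul_conjC_ge0.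
  by rewrite unitzM1 -stB mulrC => /eqP; rewrite mul_conjC_eq0 => /eqP.
have BE : B = map_mx uinj (map_mx snd B).
  by apply/matrixP => i j; rewrite !mxE; apply: unitzP; rewrite //= B0.
exists (map_mx snd B); apply: map_uinj_inj.
by rewrite map_uinjM map_uinj_star -BE sB BB.
Qed.

Lemma upos_form n (Y : 'M[A]_n) (v : 'cV[U]_n) :
  upos (vdot v (map_mx uinj (cmulmx (cstarmx Y) Y) *m v)).
Proof.
rewrite map_uinjM map_uinj_star -mulmxA -vdot_mstar; exact: upos_vdot.
Qed.

Lemma vdot_form_bound n s d (D : 'M[A]_n) (v : 'cV[U]_n) :
  0 <= d -> (forall i, ubd s (v i 0)) -> (forall i j, rnorm (D i j) <= d) ->
  ubd (\sum_(i < n) \sum_(j < n) s * (d * s)) (vdot v (map_mx uinj D *m v)).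
Proof.
move=> d0 hs hD; have bd_sum (F : 'I_n -> U) t : (forall i, ubd t (F i)) ->
    ubd (\sum_(i < n) t) (\sum_i F i).
  move=> h; elim/big_rec2: _ => [|i x y _]; first exact: bd00 ballU.
  exact: (bdD ballU).
apply: (bd_sum) => i; rewrite mxE mulr_sumr; apply: bd_sum => j.
apply: (bdM ballU); first exact: ubd_star.
by apply: (bdM ballU) => //; rewrite mxE; apply/ubd_inj.
Qed.

Lemma csq_continuous n (w : 'cV[A]_n) e : 0 < e -> exists2 d, 0 < d &
  forall w' : 'cV[A]_n, (forall i, rnorm (w i 0 - w' i 0) <= d) ->
    rnorm (csq w - csq w') <= e.
Proof.
move=> e0; pose M := \sum_i rnorm (w i 0).
have M0 : 0 <= M by apply: sumr_ge0 => i _; exact: rnorm_ge0.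
have hM i : rnorm (w i 0) <= M.
  by rewrite /M (bigD1 i) //= lerDl sumr_ge0 // => j _; exact: rnorm_ge0.
(* Each term of the difference is at most d (2 M + d) <= d (2 M + 1); n + 1 keeps k positive for n =
   0. *)
pose k := (n%:R + 1) * (2 * M + 1).
have n0 : 0 <= n%:R :> R by [].
have k0 : 0 < k by rewrite mulr_gt0 //; lra.
exists (Num.min 1 (e / k)) => [|w' hw']; first by rewrite lt_min ltr01 divr_gt0.
set d := Num.min _ _ in hw'.
have d0 : 0 < d by rewrite lt_min ltr01 divr_gt0.
have d1 : d <= 1 by rewrite ge_min lexx.
have dk : d * k <= e by rewrite -ler_pdivlMr // ge_min lexx orbT.
have rsum (F : 'I_n -> A) t : (forall i, rnorm (F i) <= t) ->
    rnorm (\sum_i F i) <= \sum_(i < n) t.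
  move=> h; elim/big_rec2: _ => [|i x y _ IH]; first by rewrite rnorm0.
  by apply: le_trans (rnormD _ _) _; exact: lerD.
rewrite /csq -sumrB.
apply: le_trans (_ : \sum_(i < n) (d * (2 * M + 1)) <= _); last first.
  rewrite sumr_const card_ord -[_ *+ n]mulr_natl.
  apply: le_trans dk; rewrite /k mulrCA ler_pM2l // ler_wpM2r //; lra.
apply: rsum => i; set x := w i 0; set y := w' i 0.
have hx : rnorm x <= M := hM i.
have hxy : rnorm (x - y) <= d := hw' i.
have hy : rnorm y <= M + d.
  have -> : y = x - (x - y) by rewrite subKr.
  by apply: le_trans (rnormB _ _) _; exact: lerD.
have -> : cmul (cstar x) x - cmul (cstar y) y =
    cmul (cstar x) (x - y) + cmul (cstar (x - y)) y.
  by rewrite cmulBr cstarB cmulBl addrA subrK.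
apply: le_trans (rnormD _ _) _.
have h1 := rnormM (cstar x) (x - y); have h2 := rnormM (cstar (x - y)) y.
rewrite !rnorm_star in h1 h2.
have h3 : rnorm x * rnorm (x - y) <= M * d by apply: ler_pM; rewrite ?rnorm_ge0.
have h4 : rnorm (x - y) * rnorm y <= d * (M + d) by apply: ler_pM; rewrite ?rnorm_ge0.
have : d * d <= d * 1 by rewrite ler_pM2l.
lra.
Qed.

End Embedding.

(** * Means on a compact group *)

Section CompactGroup.
Variable G : topGroupType.

Lemma mulg_cvg (T : Type) (F : set_system T) {FF : Filter F} (f h : T -> G) (a b : G) :
  f @ F --> a -> h @ F --> b -> (fun x => (f x * h x)%g) @ F --> (a * b)%g.
Proof.
move=> fa hb.
exact: (cvg_comp _ _ (cvg_pair fa hb) (@mulg_continuous G (a, b))).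
Qed.

Lemma compact_net (P : G -> G -> Prop) : compact [set: G] ->
  (forall t, \forall g \near t, P t g) ->
  exists l : seq G, forall g, exists2 t, t \in l & P t g.
Proof.
move=> /compact_near_coveringP cG hP.
(* Eventually along [F] means for all lists that contain some fixed list, so the near-covering form
   of compactness yields one list serving every g. *)
pose F : set_system (seq G) :=
  [set Q : set (seq G) | exists l0 : seq G, forall l : seq G, {subset l0 <= l} -> Q l].
have FF : Filter F.
  split; first by exists [::].
  - move=> Q1 Q2 [l1 h1] [l2 h2]; exists (l1 ++ l2) => l sl.
    by split; [apply: h1|apply: h2] => x xl; apply: sl; rewrite mem_cat xl ?orbT.
  - by move=> Q1 Q2 sQ [l1 h1]; exists l1 => l /h1; exact: sQ.
have := cG (seq G) F (fun l g => exists2 t, t \in l & P t g) FF.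
move=> [x _|l0 h].
  exists ([set g | P x g], [set l : seq G | x \in l]); first split => /=.
  - exact: hP.
  - by exists [:: x] => l; apply; rewrite inE.
  - by move=> [g l] /= [Pg xl]; exists x.
by exists l0 => g; apply: h.
Qed.

(** Around each x the inequality holds jointly for points near x and v near 1; near-covering
    compactness makes the neighbourhood of 1 common to all points. *)
Lemma compact_left_uniform (R : realType) (f : G -> R) e :
  compact [set: G] -> continuous f -> 0 < e ->
  \forall v \near (1%g : G), forall g, `|f (v * g)%g - f g| <= e.
Proof.
move=> /compact_near_coveringP cG cf e0.
have := cG G (nbhs (1%g : G)) (fun v g => `|f (v * g)%g - f g| <= e) _.
move=> h; have {h} : \forall v \near (1%g : G), [set: G] `<=`
    (fun g => `|f (v * g)%g - f g| <= e).
  apply: h => x _ /=.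
  have c1 : (fun p : G * G => f (p.2 * p.1)%g) @ (x, 1%g : G) --> f x.
    have h1 : (fun p : G * G => (p.2 * p.1)%g) @ (x, 1%g : G) --> x.
      by rewrite -[X in _ --> X]mul1g; apply: mulg_cvg; [exact: cvg_snd|exact: cvg_fst].
    exact: (cvg_comp _ _ h1 (cf x)).
  have c2 : (fun p : G * G => f p.1) @ (x, 1%g : G) --> f x.
    have h1 : (fun p : G * G => p.1) @ (x, 1%g : G) --> x by exact: cvg_fst.
    exact: (cvg_comp _ _ h1 (cf x)).
  have : (fun p : G * G => f (p.2 * p.1)%g - f p.1) @ (x, 1%g : G) --> f x - f x by exact: cvgB.
  rewrite subrr => /cvgrPdist_le /(_ e e0).
  by apply: filterS => p /=; rewrite sub0r normrN.
by apply: filterS => v h g; exact: h.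
Qed.

End CompactGroup.

Section Means.
Variables (R : realType) (G : topGroupType).

(** Finitely supported probability measures kept as syntax: one combination can be evaluated on real
    functions and on A-valued ones, and whatever convex combinations preserve follows by
    induction. *)
Inductive mean : Type :=
| mean_pt of G
| mean_mix (c : R) of 0 <= c <= 1 & mean & mean.

Fixpoint mean_val (m : mean) (F : G -> R) : R :=
  match m with
  | mean_pt g => F g
  | mean_mix c _ m1 m2 => c * mean_val m1 F + (1 - c) * mean_val m2 F
  end.

Fixpoint mean_map (f : G -> G) (m : mean) : mean :=
  match m with
  | mean_pt g => mean_pt (f g)
  | mean_mix c hc m1 m2 => mean_mix hc (mean_map f m1) (mean_map f m2)
  end.

(** Convolution, by which [m] averages further without losing what [m'] has achieved uniformly over
    left translations. *)
Fixpoint mean_conv (m m' : mean) : mean :=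
  match m with
  | mean_pt g => mean_map (fun h => (g * h)%g) m'
  | mean_mix c hc m1 m2 => mean_mix hc (mean_conv m1 m') (mean_conv m2 m')
  end.

Lemma mean_val_map f m F : mean_val (mean_map f m) F = mean_val m (F \o f).
Proof. by elim: m => //= c hc m1 -> m2 ->. Qed.

Lemma mean_val_conv m m' F :
  mean_val (mean_conv m m') F = mean_val m (fun g => mean_val m' (fun h => F (g * h)%g)).
Proof. by elim: m => [g|c hc m1 IH1 m2 IH2] /=; [rewrite mean_val_map|rewrite IH1 IH2]. Qed.

Lemma mean_val_le m F b : (forall g, F g <= b) -> mean_val m F <= b.
Proof. by move=> h; elim: m => //= c /andP[c0 c1] m1 h1 m2 h2; nra. Qed.

Lemma mean_val_ge m F a : (forall g, a <= F g) -> a <= mean_val m F.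
Proof. by move=> h; elim: m => //= c /andP[c0 c1] m1 h1 m2 h2; nra. Qed.

Lemma mean_val_dist m F F' e : (forall g, `|F g - F' g| <= e) ->
  `|mean_val m F - mean_val m F'| <= e.
Proof.
move=> h; elim: m => //= c /andP[c0 c1] m1 h1 m2 h2.
move: h1 h2; rewrite !ler_norml => /andP[a1 a2] /andP[b1 b2].
by apply/andP; split; nra.
Qed.

Lemma mean_val_continuous m (f : G -> R) :
  continuous f -> continuous (fun g => mean_val m (fun h => f (g * h)%g)).
Proof.
move=> cf; elim: m => [h|c hc m1 IH1 m2 IH2] x /=.
  have h1 : (fun g => (g * h)%g) @ x --> (x * h)%g.
    by apply: mulg_cvg; [exact: cvg_id|exact: cvg_cst].
  exact: (cvg_comp _ _ h1 (cf _)).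
apply: cvgD; apply: cvgM; [exact: cvg_cst|exact: IH1|exact: cvg_cst|exact: IH2].
Qed.

(** The mean has weight at least theta = 2^-(length of l) at each point of l, so a single low value
    there lowers the average. Theta comes before F because F changes at every step of the
    oscillation argument. *)
Lemma seq_mean (g0 : G) (l : seq G) : exists m theta, [/\ 0 < theta, theta <= 1 &
  forall F b b', b' <= b -> (forall g, F g <= b) ->
    (exists2 h, h \in l & F h <= b') -> mean_val m F <= b - theta * (b - b')].
Proof.
elim: l => [|h l [m [th [th0 th1 hm]]]].
  by exists (mean_pt g0), 1; split=> // F b b' _ _ [].
have hc : 0 <= (2^-1 : R) <= 1 by apply/andP; split; lra.
exists (mean_mix hc (mean_pt h) m), (th / 2); split; [lra|lra|].
move=> F b b' bb Fb [h' h'l Fh'] /=.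
move: h'l; rewrite inE => /predU1P[E|h'l].
  have := mean_val_le m Fb; rewrite -E; nra.
have := hm F b b' bb Fb (ex_intro2 _ _ h' h'l Fh'); have := Fb h; lra.
Qed.

Lemma compact_mean_right (f : G -> R) e : compact [set: G] -> continuous f -> 0 < e ->
  exists m c, forall g, `|mean_val m (fun h => f (g * h)%g) - c| <= e.
Proof.
move=> cG cf e0; pose d := e / 4; have d0 : 0 < d by rewrite divr_gt0.
have hV := compact_left_uniform cG cf d0.
(* For every g some t in l makes g t^-1 so close to 1 that left translation by it moves f by at most
   d. Averages of right translates of f inherit this with the same l and d. *)
have [l hl] : exists l : seq G, forall g, exists2 t, t \in l &
    forall x, `|f (g * t^-1 * x)%g - f x| <= d.
  apply: (@compact_net G (fun t g => forall x, `|f (g * t^-1 * x)%g - f x| <= d)) => // t.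
  have : (fun g : G => (g * t^-1)%g) @ t --> (1%g : G).
    rewrite -(mulgV t); apply: mulg_cvg; [exact: cvg_id|exact: cvg_cst].
  by move/(_ _ hV).
have [m0 [th [th0 th1 hm0]]] := seq_mean 1%g [seq (t^-1)%g | t <- l].
(* r bounds the oscillation of an average. While b - a exceeds 4 d = e, either no value lies below
   the midpoint, and a rises to it, or a low value at g0 is spread by [m0]: for every g some g t^-1
   g0 has a value at most midpoint + d, more than d below b, so b drops by at least th * d. *)
pose osc r := exists m a b, (forall g, a <= mean_val m (fun h => f (g * h)%g) <= b) /\ b - a <= r.
have osc_step r : osc r -> osc (Num.max (4 * d) (r - th * d)).
  move=> [m [a [b [hab abr]]]].
  have [r4|r4] := leP (b - a) (4 * d).
    by exists m, a, b; split=> //; rewrite le_max r4.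
  set phi := fun g => mean_val m (fun h => f (g * h)%g).
  have [[g0 hg0]|hno] := pselect (exists g0, phi g0 <= (a + b) / 2); last first.
    exists m, ((a + b) / 2), b; split=> [g|].
      have /andP[_ ->] := hab g; rewrite andbT.
      by case: leP => // /ltW hg; case: hno; exists g.
    by rewrite le_max; apply/orP; right; nra.
  pose m1 := mean_conv (mean_map (fun t => (t * g0)%g) m0) m.
  have E g : mean_val m1 (fun h => f (g * h)%g) = mean_val m0 (fun t => phi (g * (t * g0))%g).
    rewrite mean_val_conv mean_val_map; congr mean_val; apply/funext => t /=.
    by rewrite /phi; congr mean_val; apply/funext => h; rewrite mulgA.
  exists m1, a, (b - th * (b - ((a + b) / 2 + d))); split=> [g|]; last first.
    by rewrite le_max; apply/orP; right; nra.
  rewrite E mean_val_ge => [/=|t]; last by case/andP: (hab (g * (t * g0))%g).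
  apply: hm0; [lra|by move=> t; case/andP: (hab (g * (t * g0))%g)|].
  have [t tl ht] := hl g; exists (t^-1)%g; first exact: map_f.
  have : `|phi (g * (t^-1 * g0))%g - phi g0| <= d.
    by apply: mean_val_dist => h; rewrite !mulgA -(mulgA _ g0 h); exact: ht.
  by rewrite ler_norml => /andP[_]; lra.
pose D := \sum_(t <- l) `|f t| + d.
have fD g : `|f g| <= D.
  have [t tl ht] := hl g; have := ht t; rewrite mulgVK => h1.
  have h2 : `|f t| <= \sum_(t <- l) `|f t|.
    by rewrite (big_rem t) //= lerDl sumr_ge0.
  have : `|f g| <= `|f t| + `|f g - f t|.
    by have := ler_normD (f t) (f g - f t); rewrite subrKC.
  by rewrite /D; lra.
have osc0 : osc (2 * D).
  exists (mean_pt 1%g), (- D), D; split=> [g|]; last by lra.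
  by rewrite -ler_norml; exact: fD.
have osc_mono r s : r <= s -> osc r -> osc s.
  by move=> rs [m [a [b [h1 h2]]]]; exists m, a, b; split=> //; exact: le_trans rs.
have osc_k k : osc (Num.max (4 * d) (2 * D - k%:R * (th * d))).
  elim: k => [|k /osc_step]; first by apply: osc_mono osc0; rewrite mul0r subr0 le_max lexx orbT.
  apply: osc_mono; rewrite ge_max le_max lexx /= mulrSr.
  rewrite !le_max maxEle; case: ifP => _; apply/orP; [right|left]; first by lra.
  have := mulr_gt0 th0 d0; lra.
have td0 := mulr_gt0 th0 d0.
pose k := Num.Def.archi_bound (2 * D / (th * d)).
have D0 : 0 <= D by apply: le_trans (fD 1%g).
have hk : 2 * D - k%:R * (th * d) <= 4 * d.
  have : 2 * D / (th * d) < k%:R.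
    by apply: archi_boundP; apply: divr_ge0; [exact: mulr_ge0|exact: ltW].
  rewrite ltr_pdivrMr //; lra.
have [m [a [b [hab abd]]]] := osc_k k.
exists m, a => g; have /andP[h1 h2] := hab g.
move: abd; rewrite (max_idPl hk) => abd.
rewrite ger0_norm ?subr_ge0 //; move: abd; rewrite /d => abd; lra.
Qed.

End Means.

(** * Means of functions with values in the algebra *)

Section VectorMean.
Variables (R : realType) (A : cstarAlgType R) (G : topGroupType).
Local Notation mean := (mean R G).

Fixpoint mean_vec (m : mean) (F : G -> A) : A :=
  match m with
  | mean_pt g => F g
  | mean_mix c _ m1 m2 => cR c *: mean_vec m1 F + cR (1 - c) *: mean_vec m2 F
  end.

Lemma cR_convex c (y : A) : cR c *: y + cR (1 - c) *: y = y.
Proof. by rewrite -scalerDl -rmorphD subrKC rmorph1 scale1r. Qed.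

Lemma mean_vec_map f m F : mean_vec (mean_map f m) F = mean_vec m (F \o f).
Proof. by elim: m => //= c hc m1 -> m2 ->. Qed.

Lemma mean_vec_conv m m' F :
  mean_vec (mean_conv m m') F = mean_vec m (fun g => mean_vec m' (fun h => F (g * h)%g)).
Proof. by elim: m => [g|c hc m1 IH1 m2 IH2] /=; [rewrite mean_vec_map|rewrite IH1 IH2]. Qed.

Lemma mean_vec_morph (f : A -> A) m F :
  (forall c x y, f (cR c *: x + cR (1 - c) *: y) = cR c *: f x + cR (1 - c) *: f y) ->
  f (mean_vec m F) = mean_vec m (f \o F).
Proof. by move=> hf; elim: m => //= c hc m1 <- m2 <-. Qed.

Lemma mean_vec_linear m (a : Cplx R) F F' :
  mean_vec m (fun g => a *: F g + F' g) = a *: mean_vec m F + mean_vec m F'.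
Proof.
elim: m => //= c hc m1 -> m2 ->.
by rewrite !scalerDr !scalerA ![a * _]mulrC addrACA.
Qed.

Lemma mean_vec_cst m y : mean_vec m (fun=> y) = y.
Proof. by elim: m => //= c hc m1 -> m2 ->; exact: cR_convex. Qed.

Lemma mean_vec_swap m m' (F : G -> G -> A) :
  mean_vec m (fun g => mean_vec m' (F g)) = mean_vec m' (fun h => mean_vec m (F^~ h)).
Proof.
elim: m => [g|c hc m1 IH1 m2 IH2] //=; rewrite IH1 IH2.
elim: m' {IH1 IH2} => [g|d hd m1' IH1 m2' IH2] //=.
rewrite -IH1 -IH2 !scalerDr !scalerA ![cR d * _]mulrC ![cR (1 - d) * _]mulrC.
by rewrite addrACA.
Qed.

Lemma mean_vec_scal m (p : G -> R) (a : A) :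
  mean_vec m (fun g => cR (p g) *: a) = cR (mean_val m p) *: a.
Proof.
elim: m => //= c hc m1 -> m2 ->.
by rewrite !scalerA -scalerDl -!rmorphM -rmorphD.
Qed.

Lemma mean_vec_dist m F F' e : (forall g, rnorm (F g - F' g) <= e) ->
  rnorm (mean_vec m F - mean_vec m F') <= e.
Proof.
move=> h; elim: m => //= c /andP[c0 c1] m1 h1 m2 h2.
rewrite opprD addrACA -!scalerBr; apply: le_trans (rnormD _ _) _.
rewrite !rnormZ !cmod_cR !ger0_norm ?subr_ge0 //; nra.
Qed.

Lemma mean_vec_near m F y e : (forall g, rnorm (F g - y) <= e) ->
  rnorm (mean_vec m F - y) <= e.
Proof. by move=> h; rewrite -[y in X in X <= _](mean_vec_cst m y); exact: mean_vec_dist. Qed.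

Lemma mean_vec_sum m (I : Type) (r : seq I) (F : I -> G -> A) :
  mean_vec m (fun g => \sum_(i <- r) F i g) = \sum_(i <- r) mean_vec m (F i).
Proof.
elim: r => [|i r IH].
  by rewrite big_nil -[RHS](mean_vec_cst m); congr mean_vec; apply/funext => g; rewrite big_nil.
rewrite big_cons -IH -[mean_vec m (F i)]scale1r -mean_vec_linear.
by congr mean_vec; apply/funext => g; rewrite big_cons scale1r.
Qed.

Lemma rnorm_sum (I : Type) (r : seq I) (F : I -> A) :
  rnorm (\sum_(i <- r) F i) <= \sum_(i <- r) rnorm (F i).
Proof.
elim/big_rec2: _ => [|i x y _ IH]; first by rewrite rnorm0.
by apply: le_trans (rnormD _ _) _; rewrite lerD2l.
Qed.

Lemma ler_rnorm_dist (x y : A) : `|rnorm x - rnorm y| <= rnorm (x - y).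
Proof.
rewrite ler_norml; apply/andP; split.
  rewrite lerBrDr -lerBrDl opprK addrC -lerBlDr.
  have := rnormD x (y - x); rewrite subrKC -opprB rnormN; lra.
by have := rnormD y (x - y); rewrite subrKC; lra.
Qed.

Lemma rnorm_continuous (F : G -> A) (y : A) :
  continuous F -> continuous (fun g => rnorm (F g - y)).
Proof.
move=> cF x; apply/cvgrPdist_le => /= e e0.
have e0' : 0 < cR e by rewrite cR_gt0.
have /cvgrPdist_le /(_ _ e0') := cF x.
apply: filterS => g /=; rewrite rnormE cR_le => h.
apply: le_trans (ler_rnorm_dist _ _) _.
by rewrite opprB addrA subrK.
Qed.

(* The continuous functions [p t] form a partition of unity subordinate to the
   balls of radius [e / 2] around the points [F t]. *)
Lemma partition_mean (F : G -> A) e :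
  compact [set: G] -> continuous F -> 0 < e ->
  exists (l : seq G) (p : G -> G -> R) (d : R),
    [/\ 0 < d, forall t, continuous (p t) & forall c : G -> R, exists y,
      forall (m : mean) (phi : G -> G),
        (forall t, t \in l -> `|mean_val m (p t \o phi) - c t| <= d) ->
        rnorm (mean_vec m (F \o phi) - y) <= e].
Proof.
move=> cG cF e0; pose r := e / 4; have r0 : 0 < r by rewrite divr_gt0.
have [l hl] : exists l : seq G, forall g, exists2 t, t \in l & rnorm (F g - F t) <= r.
  apply: (@compact_net G (fun t g => rnorm (F g - F t) <= r)) => // t.
  have r0' : 0 < cR r by rewrite cR_gt0.
  have /cvgrPdist_le /(_ _ r0') := cF t.
  by apply: filterS => g /=; rewrite rnormE cR_le -opprB rnormN.
pose q t g := Num.max 0 (2 * r - rnorm (F g - F t)).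
have q0 t g : 0 <= q t g by rewrite le_max lexx.
pose s g := \sum_(t <- l) q t g.
have s0 g : 0 < s g.
  have [t tl ht] := hl g; rewrite /s (big_rem t) //= ltr_pwDl ?sumr_ge0 //.
  by rewrite lt_max; apply/orP; right; lra.
have cq t : continuous (q t).
  move=> x; apply: (@continuous_max _ _ (fun=> 0) (fun g => 2 * r - rnorm (F g - F t))).
    exact: cvg_cst.
  by apply: cvgB; [exact: cvg_cst|exact: rnorm_continuous].
have cs : continuous s.
  move=> x; rewrite /s; elim: (l) => [|t l' IH].
    have -> : (fun g => \sum_(t <- [::]) q t g) = cst 0.
      by apply/funext => g; rewrite big_nil.
    exact: cvg_cst.
  have -> : (fun g => \sum_(i <- t :: l') q i g) =
      (fun g => q t g + \sum_(i <- l') q i g).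
    by apply/funext => g; rewrite big_cons.
  by apply: cvgD; [exact: cq|exact: IH].
pose p t g := q t g / s g.
have p1 g : \sum_(t <- l) p t g = 1.
  by rewrite -mulr_suml -/(s g) divff ?gt_eqF.
pose K := \sum_(t <- l) rnorm (F t).
have K0 : 0 <= K by apply: sumr_ge0 => t _; exact: rnorm_ge0.
(* Errors of this size in the scalar averages cost at most 2 r in norm; replacing F by its
   approximation [F'] through the partition of unity costs another 2 r, and 4 r = e. *)
exists l, p, (2 * r / (K + 1)); split.
- by rewrite divr_gt0 // ?mulr_gt0 //; lra.
- move=> t x; apply: cvgM; first exact: cq.
  by apply: cvgV; [rewrite gt_eqF|exact: cs].
move=> c; exists (\sum_(t <- l) cR (c t) *: F t) => m phi hm.
pose F' g := \sum_(t <- l) cR (p t g) *: F t.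
have FF' g : rnorm (F g - F' g) <= 2 * r.
  have -> : F g = \sum_(t <- l) cR (p t g) *: F g.
    by rewrite -scaler_suml -rmorph_sum p1 rmorph1 scale1r.
  rewrite -sumrB; apply: le_trans (rnorm_sum _ _) _.
  have -> : 2 * r = \sum_(t <- l) 2 * r * p t g by rewrite -mulr_sumr p1 mulr1.
  apply: ler_sum => t _.
  have pt0 : 0 <= p t g by rewrite divr_ge0 // ltW.
  rewrite -scalerBr rnormZ cmod_cR ger0_norm //.
  have [h|h] := leP (rnorm (F g - F t)) (2 * r).
    by rewrite mulrC; exact: ler_wpM2r.
  rewrite /p /q; have -> : Num.max 0 (2 * r - rnorm (F g - F t)) = 0.
    by apply/max_idPl; lra.
  by rewrite !mul0r mulr0.
have h1 : rnorm (mean_vec m (F \o phi) - mean_vec m (F' \o phi)) <= 2 * r.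
  by apply: mean_vec_dist => g; exact: FF'.
have h2 : rnorm (mean_vec m (F' \o phi) - \sum_(t <- l) cR (c t) *: F t) <= 2 * r.
  have -> : mean_vec m (F' \o phi) = \sum_(t <- l) cR (mean_val m (p t \o phi)) *: F t.
    rewrite -[F' \o phi]/(fun g => \sum_(t <- l) cR (p t (phi g)) *: F t) mean_vec_sum.
    by apply: eq_bigr => t _; rewrite -mean_vec_scal.
  rewrite -sumrB; apply: le_trans (rnorm_sum _ _) _.
  apply: (@le_trans _ _ (\sum_(t <- l) 2 * r / (K + 1) * rnorm (F t))).
    rewrite !big_seq; apply: ler_sum => t tl.
    rewrite -scalerBl -rmorphB rnormZ cmod_cR ler_wpM2r ?rnorm_ge0 //.
    exact: hm.
  rewrite -mulr_sumr -/K mulrAC ler_pdivrMr; last by lra.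
  by apply: ler_wpM2l; lra.
have := rnormD (mean_vec m (F \o phi) - mean_vec m (F' \o phi))
  (mean_vec m (F' \o phi) - \sum_(t <- l) cR (c t) *: F t).
rewrite addrA subrK => h3; apply: le_trans h3 _.
by move: h1 h2; rewrite /r; lra.
Qed.

(** The functions are handled one at a time: [m'] is found for the [m]-average of p t, and p s with
    s in l, already nearly constant after [m], stays so after any further average. *)
Lemma compact_means_right (I : eqType) (l : seq I) (p : I -> G -> R) e :
  compact [set: G] -> (forall t, continuous (p t)) -> 0 < e ->
  exists (m : mean) (c : I -> R), forall t, t \in l -> forall g,
    `|mean_val m (fun h => p t (g * h)%g) - c t| <= e.
Proof.
move=> cG cp e0; elim: l => [|t l [m [c hm]]].
  by exists (mean_pt R 1%g), (fun=> 0).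
have [m' [c0 hm']] := compact_mean_right cG (@mean_val_continuous R G m _ (cp t)) e0.
exists (mean_conv m' m), (fun s => if s == t then c0 else c s) => s sl g.
rewrite mean_val_conv.
under [X in mean_val _ X]eq_fun do under [X in mean_val _ X]eq_fun do rewrite mulgA.
have [st|st] := eqVneq s t; first by rewrite st; exact: hm'.
have {}sl : s \in l by move: sl; rewrite inE (negPf st).
have cst : mean_val m' (fun=> c s) = c s by elim: (m') => //= d hd m1 -> m2 ->; ring.
by rewrite -[X in _ - X]cst; apply: mean_val_dist => k; exact: hm.
Qed.

End VectorMean.

(** * Averaging over a compact group *)

Section Action.
Variables (R : realType) (A : cstarAlgType R) (G : topGroupType)
  (alpha : G -> A -> A) (alpha_action : is_action alpha).

Lemma act_linear g a x y : alpha g (a *: x + y) = a *: alpha g x + alpha g y.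
Proof. by have [_ h _ _] := alpha_action.1 g; exact: h. Qed.

Lemma act_cmul g x y : alpha g (cmul x y) = cmul (alpha g x) (alpha g y).
Proof. by have [_ _ h _] := alpha_action.1 g; exact: h. Qed.

Lemma act_star g x : alpha g (cstar x) = cstar (alpha g x).
Proof. by have [_ _ _ h] := alpha_action.1 g; exact: h. Qed.

Lemma actM g h x : alpha (g * h)%g x = alpha g (alpha h x).
Proof. by rewrite alpha_action.2. Qed.

(** Multiplicativity makes alpha_1 idempotent, and an injective idempotent map is the identity. *)
Lemma act1 x : alpha 1%g x = x.
Proof.
have [[f fK _] _ _ _] := alpha_action.1 1%g.
by apply: (can_inj fK); rewrite -actM mulg1.
Qed.

Lemma actK g : cancel (alpha g) (alpha g^-1%g).
Proof. by move=> x; rewrite -actM mulVg act1. Qed.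

Lemma actVK g : cancel (alpha g^-1%g) (alpha g).
Proof. by move=> x; rewrite -actM mulgV act1. Qed.

Lemma act0 g : alpha g 0 = 0.
Proof.
by apply: (addrI (alpha g 0)); have := act_linear g 1 0 0; rewrite !scale1r !addr0.
Qed.

Lemma actD g x y : alpha g (x + y) = alpha g x + alpha g y.
Proof. by have := act_linear g 1 x y; rewrite !scale1r. Qed.

Lemma actZ g a x : alpha g (a *: x) = a *: alpha g x.
Proof. by have := act_linear g a x 0; rewrite act0 !addr0. Qed.

Lemma actN g x : alpha g (- x) = - alpha g x.
Proof. by rewrite -scaleN1r actZ scaleN1r. Qed.

Lemma act_sum g (I : Type) (r : seq I) (F : I -> A) :
  alpha g (\sum_(i <- r) F i) = \sum_(i <- r) alpha g (F i).
Proof. exact: (big_morph _ (actD g) (act0 g)). Qed.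

Lemma rnorm_act g x : rnorm (alpha g x) = rnorm x.
Proof.
have h k y : rnorm (alpha k y) <= rnorm y.
  by apply: star_hom_contractive; [exact: act_linear|exact: act_cmul|exact: act_star].
by apply/le_anti; rewrite h -{1}(actK g x) h.
Qed.

Lemma act_mx g m n p (X : 'M[A]_(m, n)) (Y : 'M[A]_(n, p)) :
  map_mx (alpha g) (cmulmx X Y) = cmulmx (map_mx (alpha g) X) (map_mx (alpha g) Y).
Proof.
apply/matrixP => i j; rewrite !mxE act_sum; apply: eq_bigr => k _.
by rewrite !mxE act_cmul.
Qed.

Lemma act_star_mx g m n (X : 'M[A]_(m, n)) :
  map_mx (alpha g) (cstarmx X) = cstarmx (map_mx (alpha g) X).
Proof. by apply/matrixP => i j; rewrite !mxE act_star. Qed.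

Lemma csq_act g n (v : 'cV[A]_n) : csq (map_mx (alpha g) v) = alpha g (csq v).
Proof.
by rewrite /csq act_sum; apply: eq_bigr => i _; rewrite !mxE act_cmul act_star.
Qed.

Lemma hilbert_norm_act g n (v : 'cV[A]_n) :
  hilbert_norm (map_mx (alpha g) v) = hilbert_norm v.
Proof. by rewrite /hilbert_norm -!/(csq _) csq_act rnorm_act. Qed.

Lemma map_actK g m n : cancel (@map_mx _ _ (alpha g) m n) (map_mx (alpha g^-1%g)).
Proof. by move=> X; apply/matrixP => i j; rewrite !mxE actK. Qed.

Lemma cstar_mxnorm_act g n (X : 'M[A]_n) :
  cstar_mxnorm (map_mx (alpha g) X) = cstar_mxnorm X.
Proof.
have h k (Y : 'M[A]_n) : (cstar_mxnorm (map_mx (alpha k) Y) <= cstar_mxnorm Y)%E.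
  apply: ub_ereal_sup => _ [v hv <-]; apply: ereal_sup_ubound.
  exists (map_mx (alpha k^-1%g) v) => /=; first by rewrite hilbert_norm_act.
  rewrite -(hilbert_norm_act k) act_mx.
  by congr ((hilbert_norm (cmulmx _ _))%:E); apply/matrixP => i j; rewrite !mxE actVK.
by apply/le_anti; rewrite h -{1}(map_actK g X) h.
Qed.

Lemma act_mean g (m : mean R G) F :
  alpha g (mean_vec m F) = mean_vec m (fun h => alpha g (F h)).
Proof. by apply: mean_vec_morph => c x y; rewrite actD !actZ. Qed.

Section CompactAverage.
Hypothesis alpha_continuous : forall x : A, continuous (fun g : G => alpha g x).
Hypothesis cG : compact [set: G].

(** The bound at every g, and not only at g = 1, is what lets a further average on the left stay
    near y. *)
Definition near_average (x y : A) (e : R) : Prop :=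
  exists m : mean R G, forall g, rnorm (mean_vec m (fun h => alpha (g * h)%g x) - y) <= e.

Lemma near_average_ex x e : 0 < e -> exists y, near_average x y e.
Proof.
move=> e0; have [l [p [d [d0 cp hp]]]] := partition_mean cG (@alpha_continuous x) e0.
have [m [c hm]] := compact_means_right l cG cp d0.
have [y hy] := hp c; exists y, m => g.
by apply: (hy m (fun h => (g * h)%g)) => t tl; exact: hm.
Qed.

Lemma near_left_average_ex x e : 0 < e -> exists (y : A) (m : mean R G),
  forall g, rnorm (mean_vec m (fun h => alpha (h * g)%g x) - y) <= e.
Proof.
move=> e0; have [l [p [d [d0 cp hp]]]] := partition_mean cG (@alpha_continuous x) e0.
(* Inversion exchanges left and right translates, so the right-hand result is applied to p t
   composed with it. *)
have cp' t : continuous (fun g => p t g^-1%g).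
  by move=> g; apply: (cvg_comp _ _ (@invg_continuous G g) (cp t _)).
have [m [c hm]] := compact_means_right l cG cp' d0.
have [y hy] := hp c; exists y, (mean_map (fun h => h^-1)%g m) => g.
rewrite mean_vec_map.
apply: (hy m (fun h => (h^-1 * g)%g)) => t tl; have := hm t tl g^-1%g.
by under [X in mean_val _ X]eq_fun do rewrite invgM invgK.
Qed.

(** The double average w of alpha_(k h) x is close to y when the inner mean is taken over h, and to
    the left average c when it is taken over k. Every near average of x is thus compared with the
    same c. *)
Lemma near_average_dist x y y' e e' :
  near_average x y e -> near_average x y' e' -> rnorm (y - y') <= e + e'.
Proof.
move=> [m hm] [m' hm']; apply/ler_addgt0Pr => d d0.
have d2 : 0 < d / 2 by rewrite divr_gt0.
have [c [n hn]] := near_left_average_ex x d2.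
have near z r (q : mean R G) :
    (forall g, rnorm (mean_vec q (fun h => alpha (g * h)%g x) - z) <= r) ->
    rnorm (z - c) <= r + d / 2.
  move=> hq; pose w := mean_vec n (fun k => mean_vec q (fun h => alpha (k * h)%g x)).
  have h1 : rnorm (w - z) <= r by exact: mean_vec_near.
  have h2 : rnorm (w - c) <= d / 2 by rewrite /w mean_vec_swap; exact: mean_vec_near.
  have -> : z - c = (w - c) - (w - z) by rewrite opprB [RHS]addrC addrA subrK.
  by apply: le_trans (rnormB _ _) _; lra.
have -> : y - y' = (y - c) - (y' - c) by rewrite opprB addrA subrK.
apply: le_trans (rnormB _ _) _.
by have := near _ _ _ hm; have := near _ _ _ hm'; lra.
Qed.

Lemma near_average_close x y y' e e' :
  near_average x y e -> rnorm (y - y') <= e' -> near_average x y' (e + e').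
Proof.
move=> [m hm] h; exists m => g.
rewrite -(subrKA y); apply: le_trans (rnormD _ _) _; exact: lerD.
Qed.

Lemma average_ex x : exists y, forall e, 0 < e -> near_average x y e.
Proof.
have k0 k : 0 < (k.+1%:R : R)^-1 by rewrite invr_gt0.
pose y k := projT1 (cid (near_average_ex x (k0 k))).
have hy k : near_average x (y k) (k.+1%:R)^-1 by exact: (projT2 (cid (near_average_ex x (k0 k)))).
have small e : 0 < e -> exists K, forall k, (K <= k)%N -> (k.+1%:R : R)^-1 <= e.
  move=> e0; exists (Num.Def.archi_bound e^-1) => k Kk.
  have h : e^-1 < k.+1%:R.
    apply: lt_le_trans (archi_boundP _) _; first by rewrite invr_ge0 ltW.
    by rewrite ler_nat; exact: leq_trans Kk _.
  by rewrite invf_ple ?posrE // ltW.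
have [|l hl] := @rnorm_complete R A y.
  move=> e e0; have [K hK] := small _ (divr_gt0 e0 (ltr0n R 2)).
  exists K => m n /hK hm /hK hn; apply: le_trans (near_average_dist (hy m) (hy n)) _.
  by rewrite (splitr e); exact: lerD.
exists l => e e0; have e2 := divr_gt0 e0 (ltr0n R 2).
have [K1 h1] := small _ e2; have [K2 h2] := hl _ e2.
have := h1 _ (leq_maxl K1 K2); have := h2 _ (leq_maxr K1 K2).
set k := maxn _ _ => ly ke.
have [m hm] : near_average x l (k.+1%:R^-1 + e / 2).
  by apply: near_average_close (hy k) _; rewrite -opprB rnormN.
by exists m => g; apply: le_trans (hm g) _; rewrite [leRHS](splitr e) lerD2r.
Qed.

Definition average x : A := projT1 (cid (average_ex x)).

Lemma average_near x e : 0 < e -> near_average x (average x) e.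
Proof. exact: (projT2 (cid (average_ex x))). Qed.

Lemma average_unique x y : (forall e, 0 < e -> near_average x y e) -> average x = y.
Proof.
move=> h; apply/subr0_eq/rnorm_eq0/le_anti; rewrite rnorm_ge0 andbT.
apply/ler_addgt0Pr => e e0; have e2 := divr_gt0 e0 (ltr0n R 2).
by rewrite add0r (splitr e); apply: near_average_dist (h _ e2); exact: average_near.
Qed.

(** Averaging x i by [m] leaves its limit unchanged ([zE]), so a mean good for z, convolved with
    [m], settles x i while the others stay settled. Linearity and the statements on matrices rest on
    such a common mean. *)
Lemma average_family (I : eqType) (l : seq I) (x : I -> A) e : 0 < e ->
  exists m : mean R G, forall i, i \in l -> forall g,
    rnorm (mean_vec m (fun h => alpha (g * h)%g (x i)) - average (x i)) <= e.
Proof.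
move=> e0; elim: l => [|i l [m hm]]; first by exists (mean_pt R 1%g).
pose z := mean_vec m (fun h => alpha h (x i)).
have E m' g : mean_vec m' (fun k => alpha (g * k)%g z) =
    mean_vec (mean_conv m' m) (fun h => alpha (g * h)%g (x i)).
  rewrite mean_vec_conv; congr mean_vec; apply/funext => k.
  rewrite act_mean; congr mean_vec; apply/funext => h.
  by rewrite -actM mulgA.
have zE : average (x i) = average z.
  apply: average_unique => d d0; have [m' hm'] := average_near z d0.
  by exists (mean_conv m' m) => g; rewrite -E.
have [m' hm'] := average_near z e0.
exists (mean_conv m' m) => j jl g.
have [->|ji] := eqVneq j i; first by rewrite -E zE.
have {}jl : j \in l by move: jl; rewrite inE (negPf ji).
rewrite mean_vec_conv; apply: mean_vec_near => k.
by have := hm j jl (g * k)%g; under [X in mean_vec _ X]eq_fun do rewrite -mulgA.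
Qed.

Lemma average_linear a x y : average (a *: x + y) = a *: average x + average y.
Proof.
apply: average_unique => e e0.
have k0 : 0 < cmod a + 1 by rewrite ltr_wpDl ?cmod_ge0.
have [m hm] := average_family [:: true; false] (fun b : bool => if b then x else y)
  (divr_gt0 e0 k0).
exists m => g; have hx := hm true isT g; have hy := hm false isT g.
under [X in mean_vec _ X]eq_fun do rewrite act_linear.
rewrite mean_vec_linear opprD addrACA -scalerBr; apply: le_trans (rnormD _ _) _.
rewrite rnormZ.
have := ler_wpM2l (cmod_ge0 a) hx; move: hy => /=.
have : e / (cmod a + 1) * (cmod a + 1) = e by rewrite divfK ?gt_eqF.
lra.
Qed.

Lemma average_star x : average (cstar x) = cstar (average x).
Proof.
apply: average_unique => e e0; have [m hm] := average_near x e0.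
exists m => g; under [X in mean_vec _ X]eq_fun do rewrite act_star.
rewrite -(mean_vec_morph (f := @cstar R A)).
  by rewrite -cstarB rnorm_star.
move=> c u v; rewrite cstarD !cstarZ.
by congr (_ *: _ + _ *: _); exact: (conjc_real _).
Qed.

Lemma average_invariant g x : alpha g (average x) = average x.
Proof.
apply/subr0_eq/rnorm_eq0/le_anti; rewrite rnorm_ge0 andbT.
apply/ler_addgt0Pr => e e0; rewrite add0r; have e2 := divr_gt0 e0 (ltr0n R 2).
have [m hm] := average_near x e2.
pose z := mean_vec m (fun h => alpha (1 * h)%g x).
have h1 : rnorm (alpha g z - average x) <= e / 2.
  have := hm g; rewrite /z act_mean.
  by under [X in _ -> rnorm (mean_vec _ X - _) <= _]eq_fun do rewrite -actM mul1g.
have h2 : rnorm (alpha g z - alpha g (average x)) <= e / 2.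
  by rewrite -actN -actD rnorm_act; exact: hm.
have -> : alpha g (average x) - average x =
    (alpha g z - average x) - (alpha g z - alpha g (average x)).
  by rewrite opprB [RHS]addrC addrA subrK.
by apply: le_trans (rnormB _ _) _; lra.
Qed.

Lemma average_fixed x : (forall g, alpha g x = x) -> average x = x.
Proof.
move=> hx; apply: average_unique => e e0; exists (mean_pt R 1%g) => g /=.
by rewrite hx subrr rnorm0 ltW.
Qed.

Lemma average_mx m n (X : 'M[A]_(m, n)) e : 0 < e ->
  exists q : mean R G, forall i j,
    rnorm (average (X i j) - mean_vec q (fun h => alpha h (X i j))) <= e.
Proof.
move=> e0; have [q hq] := average_family (enum {: 'I_m * 'I_n}) (fun k => X k.1 k.2) e0.
exists q => i j; have := hq (i, j) _ 1%g; rewrite mem_enum => /(_ isT) /=.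
by under [X in mean_vec _ X]eq_fun do rewrite mul1g; rewrite -opprB rnormN.
Qed.

Lemma average_completely_positive : completely_positive average.
Proof.
move=> n X0 [Y ->].
have pX g v : upos (vdot v (map_mx (@uinj R A)
    (map_mx (alpha g) (cmulmx (cstarmx Y) Y)) *m v)).
  by rewrite act_mx act_star_mx; exact: upos_form.
have sX i j : cstar (cmulmx (cstarmx Y) Y j i) = cmulmx (cstarmx Y) Y i j.
  rewrite !mxE (big_morph _ (@cstarD R A) (@cstar0 R A)).
  by apply: eq_bigr => k _; rewrite !mxE cstarM cstarK.
move: (cmulmx _ _) pX sX => {X0 Y} X pX sX; apply: mx_positive_form.
  apply/matrixP => i j.
  by rewrite mxE [map_mx _ X j i]mxE [RHS]mxE -average_star sX.
move=> v; apply: upos_closed => e e0.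
have [s hs] : exists s, forall i, ubd s (v i 0).
  have h i := bd_ex (unitz_star_ball A) (v i 0).
  exists (\sum_i projT1 (cid (h i))) => i.
  apply: (bd_le (unitz_star_ball A)) (projT2 (cid (h i))).
  rewrite (bigD1 i) //= lerDl sumr_ge0 // => j _.
  exact: (bd_ge0 (unitz_star_ball A) (projT2 (cid (h j)))).
(* Changing the entries of the matrix by d changes the form at v by at most n^2 s^2 d. *)
pose K := n%:R * n%:R * (s * s) + 1.
have K0 : 0 < K.
  by rewrite ltr_wpDl // mulr_ge0 //; exact: sqr_ge0.
have d0 := divr_gt0 e0 K0.
have [m hm] := average_mx X d0.
pose X' := map_mx (fun x => mean_vec m (fun h => alpha h x)) X.
exists (vdot v (map_mx (@uinj R A) X' *m v)).
  rewrite /X'; elim: m {hm X'} => [g|c /andP[c0 c1] m1 h1 m2 h2] /=.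
    exact: pX.
  have -> : map_mx (@uinj R A) (map_mx (fun x =>
      cR c *: mean_vec m1 (fun h => alpha h x) +
      cR (1 - c) *: mean_vec m2 (fun h => alpha h x)) X) =
    ureal A c *: map_mx (@uinj R A) (map_mx (fun x => mean_vec m1 (fun h => alpha h x)) X) +
    ureal A (1 - c) *: map_mx (@uinj R A) (map_mx (fun x => mean_vec m2 (fun h => alpha h x)) X).
    by apply/matrixP => i j; rewrite !mxE raddfD /= !ureal_inj.
  rewrite mulmxDl -!scalemxAl vdotDr !vdotZr.
  by apply: uposD; apply: uposZ; rewrite // subr_ge0.
rewrite -vdotNr -vdotDr -mulmxBl -map_mxB.
have hD i j : rnorm ((map_mx average X - X') i j) <= e / K.
  by rewrite !mxE; exact: hm.
have := vdot_form_bound (ltW d0) hs hD; apply: (bd_le (unitz_star_ball A)).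
rewrite !sumr_const card_ord -mulrnA -[_ *+ (n * n)]mulr_natl natrM.
have : e / K * K = e by rewrite divfK ?gt_eqF.
move: (e / K) d0 => d d0; rewrite /K; lra.
Qed.

Lemma average_completely_contractive :
  completely_contractive (@cstar_os R A) (@cstar_os R A) average.
Proof.
apply: ub_ereal_sup => _ [n [X [hX ->]]].
apply: ub_ereal_sup => _ [v /= hv <-].
rewrite lee_fin hilbert_norm_le // expr1n.
set w := cmulmx _ _.
apply/ler_addgt0Pr => e e0.
have [d d0 hd] := csq_continuous w e0.
pose K := \sum_j rnorm (v j 0) + 1.
have K0 : 0 < K by rewrite ltr_wpDl // sumr_ge0 // => j _; exact: rnorm_ge0.
have [m hm] := average_mx X (divr_gt0 d0 K0).
pose X' q := map_mx (fun x => mean_vec q (fun h => alpha h x)) X.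
(* For the fixed v, the images of v under the matrices alpha_g(X) lie in the unit ball, and so do
   their convex combinations by [csq_convex]. *)
have h1 q : rnorm (csq (cmulmx (X' q) v)) <= 1.
  rewrite /X'; elim: q => [g|c hc m1 h1 m2 h2] /=.
    rewrite -/(map_mx (alpha g) X) -(expr1n _ 2) -hilbert_norm_le // -lee_fin.
    have := hX; rewrite /cstar_os => /(le_trans _); apply; rewrite -(cstar_mxnorm_act g X).
    by apply: ereal_sup_ubound; exists v.
  have := csq_convex hc h1 h2; congr (rnorm (csq _) <= 1).
  apply/matrixP => i j; rewrite !mxE.
  rewrite [j]ord1 !scaler_sumr -big_split; apply: eq_bigr => k _ /=.
  by rewrite !mxE cmulDl !cmulZl.
have h2 : rnorm (csq w - csq (cmulmx (X' m) v)) <= e.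
  apply: hd => i; rewrite !mxE -sumrB; apply: le_trans (rnorm_sum _ _) _.
  apply: (@le_trans _ _ (\sum_j d / K * rnorm (v j 0))).
    apply: ler_sum => j _; rewrite !mxE -cmulBl; apply: le_trans (rnormM _ _) _.
    by apply: ler_wpM2r; [exact: rnorm_ge0|exact: hm].
  rewrite -mulr_sumr mulrAC ler_pdivrMr // ler_pM2l // /K; lra.
have -> : csq w = csq (cmulmx (X' m) v) + (csq w - csq (cmulmx (X' m) v)).
  by rewrite subrKC.
by apply: le_trans (rnormD _ _) _; exact: lerD.
Qed.

End CompactAverage.
End Action.

(** * Right uniformly continuous functions and invariant means *)

Section Amenable.
Variables (R : realType) (G : topGroupType).
Local Notation C := (Cplx R).

Lemma RUCb_intro (f : G -> C) :
  (exists M, forall s, cmod (f s) <= M) ->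
  (forall s e, 0 < e -> \forall t \near s, forall g, cmod (f (s * g)%g - f (t * g)%g) <= e) ->
  RUCb f.
Proof.
move=> [M fM] fu; split.
- move=> s; apply/cvgrPdist_le => /= e e0.
  have [e' e'0 ->] := cplx_gt0 e0.
  apply: filterS (fu s _ e'0) => t /(_ 1%g); rewrite !mulg1 => h.
  by rewrite normE cR_le.
- by exists (cR M) => s; rewrite normE cR_le.
- move=> s P /uniform_nbhs [E [entE sE]].
  move: entE; rewrite -entourage_ballE => -[e /= e0 sub].
  have [e' e'0 ee] := cplx_gt0 e0.
  (* Half of e', because a ball asks for a strict inequality. *)
  apply: filterS (fu s _ (divr_gt0 e'0 (ltr0n R 2))) => t ht.
  apply: sE => g _; apply: sub; rewrite /= -ball_normE /= normE ee cR_lt /ltrans.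
  by apply: le_lt_trans (ht g) _; rewrite ltr_pdivrMr // ltr_pMr // ltr1n.
Qed.

Lemma RUCb_bounded (f : G -> C) : RUCb f -> exists M, forall s, cmod (f s) <= M.
Proof.
move=> [_ [M hM] _]; exists (complex.Re M) => s.
by have := hM s; rewrite normE lecE => /andP[].
Qed.

Lemma RUCb_uniform (f : G -> C) s e : RUCb f -> 0 < e ->
  \forall t \near s, forall g, cmod (f (s * g)%g - f (t * g)%g) <= e.
Proof.
move=> [_ _ fu] e0.
have e0' : 0 < cR e by rewrite cR_gt0.
have := fu s [set h : {uniform G -> C} | forall g, cmod (f (s * g)%g - h g) <= e].
apply; apply/uniform_nbhs; exists [set xy | ball xy.1 (cR e) xy.2]; split.
  by rewrite -entourage_ballE; exists (cR e).
by move=> h /= hh g; have := hh g I; rewrite -ball_normE /= normE cR_lt => /ltW.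
Qed.

Lemma RUCb_lin (a : C) (f g : G -> C) : RUCb f -> RUCb g ->
  RUCb (fun s => a * f s + g s).
Proof.
move=> hf hg; have [M fM] := RUCb_bounded hf; have [N gN] := RUCb_bounded hg.
apply: RUCb_intro => [|s e e0].
  exists (cmod a * M + N) => s; apply: le_trans (cmodD _ _) _.
  by rewrite cmodM; apply: lerD => //; rewrite ler_wpM2l ?cmod_ge0.
have k0 : 0 < cmod a + 1 by rewrite ltr_wpDl ?cmod_ge0.
have d0 := divr_gt0 e0 k0.
apply: filterS2 (RUCb_uniform s hf d0) (RUCb_uniform s hg d0) => t ht1 ht2 k.
rewrite opprD addrACA -mulrBr; apply: le_trans (cmodD _ _) _; rewrite cmodM.
have := ler_wpM2l (cmod_ge0 a) (ht1 k); have := ht2 k.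
have : e / (cmod a + 1) * (cmod a + 1) = e by rewrite divfK ?gt_eqF.
lra.
Qed.

Lemma RUCb_cst (c : C) : RUCb (fun _ : G => c).
Proof.
apply: RUCb_intro => [|s e e0]; first by exists (cmod c).
by apply: nearW => t g; rewrite subrr cmod0 ltW.
Qed.

Section InvariantMean.
Variable mu : (G -> C) -> C.
Hypothesis mu_lin : forall (a : C) (f g : G -> C), RUCb f -> RUCb g ->
  mu (fun s => a * f s + g s) = a * mu f + mu g.
Hypothesis mu_norm : ereal_sup [set r : \bar R | exists f : G -> C,
  [/\ RUCb f, forall s, `|f s| <= 1 & r = (complex.Re `|mu f|)%:E]] = 1%E.
Hypothesis mu1 : mu (fun=> 1) = 1.

Lemma mu0 : mu (fun=> 0) = 0.
Proof.
have := @mu_lin (-1) (fun=> 1) (fun=> 1) (RUCb_cst 1) (RUCb_cst 1).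
by rewrite mulr1 addNr mu1 mulr1 addNr.
Qed.

Lemma mu_cst c : mu (fun=> c) = c.
Proof.
have := @mu_lin c (fun=> 1) (fun=> 0) (RUCb_cst 1) (RUCb_cst 0).
by rewrite mu1 mu0 mulr1 addr0.
Qed.

(** f / (M + e) lies in the unit ball; e > 0 covers the case M = 0. *)
Lemma mu_le f M : RUCb f -> (forall s, cmod (f s) <= M) -> cmod (mu f) <= M.
Proof.
move=> hf fM; have M0 : 0 <= M by apply: le_trans (fM 1%g); exact: cmod_ge0.
apply/ler_addgt0Pr => e e0; have k0 : 0 < M + e by rewrite ltr_wpDl.
have ki : 0 <= (M + e)^-1 by rewrite invr_ge0 ltW.
have hg := RUCb_lin (cR (M + e)^-1) hf (RUCb_cst 0).
have E := mu_lin (cR (M + e)^-1) hf (RUCb_cst 0); rewrite mu0 addr0 in E.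
have : cmod (mu (fun s => cR (M + e)^-1 * f s + 0)) <= 1.
  rewrite -lee_fin -mu_norm; apply: ereal_sup_ubound.
  exists (fun s => cR (M + e)^-1 * f s + 0); split=> // s.
  rewrite addr0 normE cmodM cmod_cR -(rmorph1 (@cR R)) cR_le.
  rewrite ger0_norm // mulrC ler_pdivrMr // mul1r.
  by apply: le_trans (fM s) _; rewrite lerDl ltW.
rewrite E cmodM cmod_cR ger0_norm // mulrC ler_pdivrMr //.
by rewrite mul1r.
Qed.

Lemma mu_dist f c M : RUCb f -> (forall s, cmod (f s - c) <= M) -> cmod (mu f - c) <= M.
Proof.
move=> hf h; have E := mu_lin 1 hf (RUCb_cst (- c)).
have <- : mu (fun s => 1 * f s + - c) = mu f - c by rewrite E mul1r mu_cst.
by apply: mu_le => [|s]; [apply: RUCb_lin => //; exact: RUCb_cst|rewrite mul1r].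
Qed.

(** Norm 1 and mu(1) = 1 force positivity, since mu sends functions with values in a closed disc
    into that disc. The disc of radius M about M gives Re >= 0; the discs of radius sqrt (M^2 + t^2)
    about i t, for all real t, give Im = 0. *)
Lemma mu_ge0 f : RUCb f -> (forall s, 0 <= f s) -> 0 <= mu f.
Proof.
move=> hf f0; have [M fM] := RUCb_bounded hf.
have fE s : f s = cR (complex.Re (f s)) by rewrite /cR RRe_real // ger0_real.
have fr s : 0 <= complex.Re (f s) <= M.
  rewrite -(cR_le 0) rmorph0 -fE f0 /= (le_trans _ (fM s)) //.
  exact: le_trans (ler_norm _) (Re_le_cmod _).
have h1 : cmod (mu f - cR M) <= M.
  apply: mu_dist => // s; rewrite fE -rmorphB cmod_cR ler_norml.
  by case/andP: (fr s); lra.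
have ReB (z : C) x : complex.Re (z - cR x) = complex.Re z - x by case: z.
have a0 : 0 <= complex.Re (mu f).
  have := Re_le_cmod (mu f - cR M); rewrite ReB ler_norml; lra.
have b0 : complex.Im (mu f) = 0.
  have h2 t : complex.Re (mu f) ^+ 2 + (complex.Im (mu f) - t) ^+ 2 <= M ^+ 2 + t ^+ 2.
    have h3 : cmod (mu f - (0 +i* t)%C) <= Num.sqrt (M ^+ 2 + t ^+ 2).
      apply: mu_dist => // s.
      rewrite -(ler_pXn2r (ltn0Sn 1)) ?nnegrE ?cmod_ge0 ?sqrtr_ge0 //.
      rewrite sqr_sqrtr ?addr_ge0 ?sqr_ge0 // cmod_sq fE /= !subr0 sub0r sqrrN lerD2r.
      by case/andP: (fr s) => r0 rM; rewrite ler_pXn2r ?nnegrE // (le_trans r0).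
    move: h3; rewrite -(ler_pXn2r (ltn0Sn 1)) ?nnegrE ?cmod_ge0 ?sqrtr_ge0 //.
    rewrite sqr_sqrtr ?addr_ge0 ?sqr_ge0 // cmod_sq.
    by case: (mu f) => x y /=; rewrite subr0.
  have [//|bn] := eqVneq (complex.Im (mu f)) 0; exfalso.
  (* This t makes - 2 t Im equal to M^2 + 1, more than [h2] allows. *)
  have := h2 (- (M ^+ 2 + 1) / (2 * complex.Im (mu f))).
  move: (complex.Re _) (complex.Im (mu f)) bn => x y y0; rewrite sqrrB.
  have -> : y * (- (M ^+ 2 + 1) / (2 * y)) *+ 2 = - (M ^+ 2 + 1) by field.
  have := sqr_ge0 x; have := sqr_ge0 y; lra.
by rewrite lecE /= b0 eqxx a0.
Qed.

Lemma mu_sum (I : Type) (r : seq I) (c : I -> C) (f : I -> G -> C) :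
  (forall i, RUCb (f i)) ->
  RUCb (fun s => \sum_(i <- r) c i * f i s) /\
  mu (fun s => \sum_(i <- r) c i * f i s) = \sum_(i <- r) c i * mu (f i).
Proof.
move=> hf; elim: r => [|i r [IH1 IH2]].
  have -> : (fun s => \sum_(i <- [::]) c i * f i s) = fun=> 0.
    by apply/funext => s; rewrite big_nil.
  by rewrite big_nil; split; [exact: RUCb_cst|exact: mu0].
have -> : (fun s => \sum_(i <- i :: r) c i * f i s) =
    fun s => c i * f i s + \sum_(i <- r) c i * f i s.
  by apply/funext => s; rewrite big_cons.
by rewrite big_cons -IH2; split; [exact: RUCb_lin|exact: mu_lin].
Qed.

(** Contractivity on scalars passes to matrices: for w = mu(F) v, |w|^2 is mu of s |-> <w, F s v>,
    whose modulus is at most (|w|^2 + |F s v|^2) / 2 <= (|w|^2 + 1) / 2. Hence |w|^2 <= 1. *)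
Lemma scalar_opnorm_mu n (F : G -> 'M[C]_n) :
  (forall i j, RUCb (fun s => F s i j)) ->
  (forall s, (scalar_opnorm (F s) <= 1)%E) ->
  (scalar_opnorm (\matrix_(i, j) mu (fun s => F s i j)) <= 1)%E.
Proof.
move=> hF nF; apply: ub_ereal_sup => _ [v /= hv <-]; rewrite lee_fin.
set w := _ *m v; pose S (u : 'cV[C]_n) := \sum_i cmod (u i 0) ^+ 2.
have l2E u : (l2norm u <= 1) = (S u <= 1).
  rewrite /l2norm -[1 in LHS]sqrtr1 ler_sqrt //.
rewrite l2E; rewrite l2E in hv.
have hFv s : S (F s *m v) <= 1.
  rewrite -l2E -lee_fin; apply: le_trans (nF s); apply: ereal_sup_ubound.
  by exists v; rewrite //= l2E.
have h1 i : RUCb (fun s => (F s *m v) i 0) /\ mu (fun s => (F s *m v) i 0) = w i 0.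
  have [h2 h3] := mu_sum (index_enum 'I_n) (fun j => v j 0) (f := fun j s => F s i j) (hF i).
  have E : (fun s => (F s *m v) i 0) = (fun s => \sum_j v j 0 * F s i j).
    by apply/funext => s; rewrite mxE; apply: eq_bigr => j _; rewrite mulrC.
  rewrite E h3; split=> //; rewrite mxE; apply: eq_bigr => j _.
  by rewrite mxE mulrC.
have [h2 h3] := mu_sum (index_enum 'I_n) (fun i => (w i 0)^*)
  (f := fun i s => (F s *m v) i 0) (fun i => (h1 i).1).
have E : \sum_i (w i 0)^* * mu (fun s => (F s *m v) i 0) = cR (S w).
  rewrite /S rmorph_sum; apply: eq_bigr => i _.
  by rewrite (h1 i).2 rmorphXn /= -normE normCKC.
have S0 : 0 <= S w by apply: sumr_ge0 => i _; exact: sqr_ge0.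
have : cmod (cR (S w)) <= (S w + 1) / 2.
  rewrite -E -h3; apply: mu_le => // s.
  apply: (@le_trans _ _ (\sum_i (cmod (w i 0) ^+ 2 + cmod ((F s *m v) i 0) ^+ 2) / 2)).
    elim/big_rec2: _ => [|i x y _ IH]; first by rewrite cmod0.
    apply: le_trans (cmodD _ _) _; apply: lerD => //.
    rewrite cmodM cmod_conj.
    have := sqr_ge0 (cmod (w i 0) - cmod ((F s *m v) i 0)); rewrite sqrrB; lra.
  rewrite -mulr_suml big_split /= -/(S w) -/(S (F s *m v)).
  by have := hFv s; lra.
rewrite cmod_cR ger0_norm //; lra.
Qed.

End InvariantMean.
End Amenable.

(** * Functionals and states *)

Section DualAverage.
Variables (R : realType) (A : cstarAlgType R).
Local Notation C := (Cplx R).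

Lemma dual_linear (phi : dual A) a x y : phi (a *: x + y) = a * phi x + phi y :> C.
Proof. by case: phi => f /= /asboolP[h _]; exact: h. Qed.

Lemma dual_continuous (phi : dual A) : continuous phi.
Proof. by case: phi => f /= /asboolP[_ h]. Qed.

Lemma dual0 (phi : dual A) : phi 0 = 0 :> C.
Proof.
by apply: (addrI (phi 0 : C)); have := dual_linear phi 1 0 0; rewrite scale1r mul1r !addr0.
Qed.

Lemma dualD (phi : dual A) x y : phi (x + y) = phi x + phi y :> C.
Proof. by have := dual_linear phi 1 x y; rewrite scale1r mul1r. Qed.

Lemma dualZ (phi : dual A) a x : phi (a *: x) = a * phi x :> C.
Proof. by have := dual_linear phi a x 0; rewrite dual0 !addr0. Qed.

Lemma dualN (phi : dual A) x : phi (- x) = - phi x :> C.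
Proof. by rewrite -scaleN1r dualZ mulN1r. Qed.

Lemma dual_bounded (phi : dual A) : exists2 K, 0 <= K &
  forall x, cmod (phi x) <= K * rnorm x.
Proof.
have /cvgrPdist_le /(_ 1 ltr01) := @dual_continuous phi 0.
move=> /nbhs_ballP[e /= e0 he].
have [d d0 ed] := cplx_gt0 e0.
have h x : rnorm x < d -> cmod (phi x) <= 1.
  move=> hx; have : ball (0 : A) e x.
    by rewrite -ball_normE /= sub0r normrN ed rnormE cR_lt.
  by move/he; rewrite /= dual0 sub0r normrN normE -(rmorph1 (@cR R)) cR_le.
exists (2 / d) => [|x]; first by rewrite divr_ge0 // ltW.
have := rnorm_ge0 x; rewrite le_eqVlt => /predU1P[x0|x0].
  by rewrite -x0 mulr0 (rnorm_eq0 (esym x0)) dual0 cmod0.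
have k0 : 0 < d / (2 * rnorm x) by rewrite divr_gt0 ?mulr_gt0.
have := h (cR (d / (2 * rnorm x)) *: x).
rewrite rnormZ dualZ cmodM cmod_cR gtr0_norm // => hh.
have : d / (2 * rnorm x) * cmod (phi x) <= 1.
  apply: hh; have -> : d / (2 * rnorm x) * rnorm x = d / 2 by field; rewrite gt_eqF.
  by lra.
have -> : 2 / d * rnorm x = (d / (2 * rnorm x))^-1 by field; rewrite !gt_eqF.
by rewrite mulrC -ler_pdivlMr // mul1r.
Qed.

Lemma dual_intro (f : A -> C) K :
  (forall a x y, f (a *: x + y) = a * f x + f y) ->
  (forall x, cmod (f x) <= K * rnorm x) -> exists phi : dual A, forall x, phi x = f x.
Proof.
move=> flin fK.
suff h : (f : A -> C^o) \in @dual_pred R A by exists (Dual h).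
apply/asboolP; split; first exact: flin.
move=> x; apply/cvgrPdist_le => /= e e0.
have [e' e'0 ->] := cplx_gt0 e0.
have k0 : 0 < `|K| + 1 by rewrite ltr_wpDl.
have d0 : 0 < cR (e' / (`|K| + 1)) by rewrite cR_gt0 divr_gt0.
have /cvgrPdist_le /(_ _ d0) := @cvg_id _ (nbhs x).
apply: filterS => y /=; rewrite rnormE cR_le => h.
have -> : (f x : C^o) - f y = f (x - y).
  by rewrite [x - y]addrC -(scaleN1r y) flin mulN1r addrC.
rewrite normE cR_le; apply: le_trans (fK _) _.
apply: (@le_trans _ _ ((`|K| + 1) * rnorm (x - y))).
  by apply: ler_wpM2r; [exact: rnorm_ge0|have := ler_norm K; lra].
by rewrite mulrC -ler_pdivlMr.
Qed.

Lemma dual_eq (phi psi : dual A) : (forall x, phi x = psi x) -> phi = psi.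
Proof. by move=> h; apply: val_inj; apply/funext. Qed.

Lemma dual_linE (a : C) (phi psi : dual A) x :
  (a *: phi + psi) x = a * phi x + psi x.
Proof. by []. Qed.

Lemma dual_norm_le (phi : dual A) x : dual_norm phi = 1%E -> rnorm x <= 1 -> cmod (phi x) <= 1.
Proof.
by move=> h hx; rewrite -lee_fin -h; apply: ereal_sup_ubound; exists x.
Qed.

Lemma unit_star e : is_unit_elt e -> @cstar R A e = e.
Proof.
move=> he; have [h _] := he (cstar e); have [_ h'] := he e.
rewrite -[LHS](he _).2 -{2}(cstarK e) -cstarM.
by rewrite (he _).2 cstarK.
Qed.

Lemma unit_rnorm (e : A) : is_unit_elt e -> rnorm e <= 1.
Proof.
move=> he; have := rnorm_star_mul e; rewrite (unit_star he) (he e).1.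
by have := rnorm_ge0 e; nra.
Qed.

(** The values at l = 1 and l = i are real, which fixes the imaginary and the real part of z'. *)
Lemma hermitian_form_conj (z z' : C) p r :
  (forall l : C, 0 <= l^* * l * cR p + l^* * z + (l * z' + cR r)) -> z' = z^*.
Proof.
have conjE (w : C) : w^* = conjc w by [].
move=> Q; have := Q 1; have := Q (0 +i* 1)%C; rewrite !conjE.
case: z z' {Q} => [a b] [a' b']; rewrite !lecE /= => /andP[/eqP h1 _] /andP[/eqP h2 _].
by congr Complex; lra.
Qed.

Lemma hermitian_form_real (z : C) p r s :
  0 <= (cR (- s) * z)^* * (cR (- s) * z) * cR p + (cR (- s) * z)^* * z +
       (cR (- s) * z * z^* + cR r) ->
  0 <= s ^+ 2 * cmod z ^+ 2 * p - 2 * s * cmod z ^+ 2 + r.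
Proof.
have conjE (w : C) : w^* = conjc w by [].
rewrite !conjE cmod_sq; case: z => [a b]; rewrite lecE /= => /andP[_]; lra.
Qed.

(* Cauchy-Schwarz for the positive form [(x, y) |-> phi (x^* y)]. *)
Lemma state_unit (phi : dual A) e : is_unit_elt e -> state phi -> 1 <= complex.Re (phi e).
Proof.
move=> he [pphi nphi]; set p := complex.Re (phi e).
have se := unit_star he.
have phe : phi e = cR p.
  have := pphi e; rewrite se (he e).1 => h.
  by rewrite /p /cR RRe_real // ger0_real.
have p0 : 0 <= p by have := pphi e; rewrite se (he e).1 phe cR_ge0.
have expand (l : C) x : phi (cmul (cstar (l *: e + x)) (l *: e + x)) =
    l^* * l * phi e + l^* * phi x + (l * phi (cstar x) + phi (cmul (cstar x) x)) :> C.
  rewrite cstarD cstarZ se cmulDl !cmulDr !cmulZl !cmulZr (he e).1 (he x).1 (he (cstar x)).2.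
  by rewrite scalerA !dualD !dualZ.
have bound x : rnorm x <= 1 -> cmod (phi x) ^+ 2 <= p.
  move=> hx; set z : C := phi x; set z' : C := phi (cstar x).
  set c : C := phi (cmul (cstar x) x).
  have cE : c = cR (complex.Re c) by rewrite /cR RRe_real // ger0_real //; exact: pphi.
  have c0 : 0 <= complex.Re c by have := pphi x; rewrite -/c [in X in X -> _]cE cR_ge0.
  have c1 : complex.Re c <= 1.
    apply: le_trans (ler_norm _) _; apply: le_trans (Re_le_cmod _) _.
    apply: dual_norm_le => //; rewrite rnorm_star_mul expr2.
    by have := rnorm_ge0 x; nra.
  have Q (l : C) : 0 <= l^* * l * cR p + l^* * z + (l * z' + c).
    by have := pphi (l *: e + x); rewrite expand phe.
  have zz : z' = z^*.
    by apply: (@hermitian_form_conj z z' p (complex.Re c)); rewrite -cE; exact: Q.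
  have h s : 0 <= s ^+ 2 * cmod z ^+ 2 * p - 2 * s * cmod z ^+ 2 + complex.Re c.
    by have := Q (cR (- s) * z); rewrite zz [in X in X -> _]cE => /hermitian_form_real.
  (* For p > 0 the quadratic in [h] is minimal at s = 1 / p. For p = 0 it is affine in s, and s = 1
     / |z|^2 would make it Re c - 2 < 0, so z = 0. *)
  have [pp|pp] := ltP 0 p.
    have := h p^-1.
    have -> : p^-1 ^+ 2 * cmod z ^+ 2 * p - 2 * p^-1 * cmod z ^+ 2 = - (cmod z ^+ 2 / p).
      by field; rewrite gt_eqF.
    move=> h1; have : cmod z ^+ 2 / p <= 1 by lra.
    by rewrite ler_pdivrMr // mul1r.
  have {}pp : p = 0 by apply/le_anti; rewrite pp p0.
  rewrite pp in h *; rewrite leNgt; apply/negP => z0.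
  have := h (1 / cmod z ^+ 2); move: z0; move: (cmod z ^+ 2) => w w0.
  have -> : 2 * (1 / w) * w = 2 by field; rewrite gt_eqF.
  by rewrite mulr0; lra.
have : (1 <= (Num.sqrt p)%:E)%E.
  rewrite -nphi; apply: ub_ereal_sup => _ [x /= hx <-]; rewrite lee_fin.
  rewrite -(ler_pXn2r (ltn0Sn 1)) ?nnegrE ?sqrtr_ge0 ?cmod_ge0 // sqr_sqrtr //.
  exact: bound.
rewrite lee_fin => h; have := sqr_sqrtr p0; nra.
Qed.

End DualAverage.

Section DualAverageAction.
Variables (R : realType) (A : cstarAlgType R) (G : topGroupType)
  (alpha : G -> A -> A) (alpha_action : is_action alpha)
  (alpha_continuous : forall x : A, continuous (fun g : G => alpha g x)).
Local Notation C := (Cplx R).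

(* The inverse is what makes the coefficient left uniformly continuous. *)
Definition coef (phi : dual A) (x : A) : G -> C := fun s => phi (alpha s^-1%g x).

Lemma coef_linear phi a x y :
  coef phi (a *: x + y) = fun s => a * coef phi x s + coef phi y s.
Proof. by apply/funext => s; rewrite /coef (act_linear alpha_action) dual_linear. Qed.

Lemma coef_le (phi : dual A) x K : (forall y, cmod (phi y) <= K * rnorm y) ->
  forall s, cmod (coef phi x s) <= K * rnorm x.
Proof. by move=> h s; rewrite -(rnorm_act alpha_action s^-1%g x); exact: h. Qed.

Lemma coef_RUCb phi x : RUCb (coef phi x).
Proof.
have [K K0 hK] := dual_bounded phi.
apply: RUCb_intro => [|s e e0]; first by exists (K * rnorm x) => s; exact: coef_le.
have k0 : 0 < K + 1 by rewrite ltr_wpDl.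
have d0 : 0 < cR (e / (K + 1)) by rewrite cR_gt0 divr_gt0.
have cs : (fun t => alpha t^-1%g x) @ s --> alpha s^-1%g x.
  exact: (cvg_comp _ _ (@invg_continuous G s) (@alpha_continuous x _)).
have /cvgrPdist_le /(_ _ d0) := cs.
apply: filterS => t /=; rewrite rnormE cR_le => h g.
rewrite /coef !invgM !(actM alpha_action) -dualN -dualD -(actN alpha_action).
rewrite -(actD alpha_action); apply: le_trans (hK _) _; rewrite (rnorm_act alpha_action).
apply: (@le_trans _ _ ((K + 1) * (e / (K + 1)))).
  by apply: ler_pM => //; [exact: rnorm_ge0|lra].
by rewrite mulrC divfK ?gt_eqF.
Qed.

Lemma coef_shift phi t x : coef phi (alpha t x) = ltrans t^-1%g (coef phi x).
Proof.
by apply/funext => s; rewrite /coef /ltrans -(actM alpha_action) invgM invgK.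
Qed.

Section WithMean.
Variable mu : (G -> C) -> C.
Hypothesis mu_lin : forall (a : C) (f g : G -> C), RUCb f -> RUCb g ->
  mu (fun s => a * f s + g s) = a * mu f + mu g.
Hypothesis mu_norm : ereal_sup [set r : \bar R | exists f : G -> C,
  [/\ RUCb f, forall s, `|f s| <= 1 & r = (complex.Re `|mu f|)%:E]] = 1%E.
Hypothesis mu1 : mu (fun=> 1) = 1.
Hypothesis mu_inv : forall (t : G) (f : G -> C), RUCb f -> mu (ltrans t f) = mu f.

Lemma dual_average_ex (phi : dual A) : exists psi : dual A, forall x, psi x = mu (coef phi x).
Proof.
have [K K0 hK] := dual_bounded phi.
apply: (@dual_intro R A _ K) => [a x y|x].
  by rewrite coef_linear mu_lin //; exact: coef_RUCb.
apply: (mu_le mu_lin mu_norm mu1); first exact: coef_RUCb.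
exact: coef_le.
Qed.

Definition dual_average (phi : dual A) : dual A := projT1 (cid (dual_average_ex phi)).

Lemma dual_averageE phi x : dual_average phi x = mu (coef phi x).
Proof. exact: (projT2 (cid (dual_average_ex phi))). Qed.

Lemma dual_average_linear a phi psi :
  dual_average (a *: phi + psi) = a *: dual_average phi + dual_average psi.
Proof.
apply: dual_eq => x; rewrite dual_linE !dual_averageE.
by rewrite -mu_lin; [|exact: coef_RUCb|exact: coef_RUCb].
Qed.

Lemma dual_average_invariant phi : invariant_functional alpha (dual_average phi).
Proof.
by move=> g x; rewrite !dual_averageE coef_shift mu_inv //; exact: coef_RUCb.
Qed.

Lemma dual_average_fixed phi : invariant_functional alpha phi -> dual_average phi = phi.
Proof.
move=> h; apply: dual_eq => x; rewrite dual_averageE.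
have -> : coef phi x = fun=> phi x by apply/funext => s; rewrite /coef h.
exact: (mu_cst mu_lin mu1).
Qed.

Lemma dual_average_state phi : unital A -> state phi -> state (dual_average phi).
Proof.
move=> [e he] sphi; have [pphi nphi] := sphi; split=> [x|].
  rewrite dual_averageE; apply: (mu_ge0 mu_lin mu_norm mu1); first exact: coef_RUCb.
  by move=> s; rewrite /coef (act_cmul alpha_action) (act_star alpha_action).
apply/le_anti/andP; split.
  apply: ub_ereal_sup => _ [x /= hx <-]; rewrite lee_fin.
  rewrite -[rnorm _]/(cmod _) dual_averageE.
  apply: (mu_le mu_lin mu_norm mu1) => [|s]; first exact: coef_RUCb.
  by apply: dual_norm_le => //; rewrite (rnorm_act alpha_action).
(* The norm is attained at the unit: every automorphism fixes e, so the coefficient there is the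
   constant phi e, whose modulus is at least 1 by [state_unit]. *)
apply: ereal_sup_ge; exists (cmod (dual_average phi e))%:E.
  by exists e => //=; exact: unit_rnorm.
have ae g : alpha g e = e.
  have [h _] := he (alpha g e).
  rewrite -[LHS]h -{1}(actVK alpha_action g e) -(act_cmul alpha_action).
  by rewrite (he _).2 (actVK alpha_action).
rewrite lee_fin dual_averageE.
have -> : coef phi e = fun=> phi e by apply/funext => s; rewrite /coef ae.
rewrite (mu_cst mu_lin mu1).
apply: le_trans (state_unit he sphi) _; apply: le_trans (ler_norm _) (Re_le_cmod _).
Qed.

Lemma dual_average_cb : completely_bounded (@dual_os R A) (@dual_os R A) dual_average.
Proof.
apply: (@le_lt_trans _ _ 1%E); last exact: ltry.
apply: ub_ereal_sup => _ [n [Phi [hPhi ->]]].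
apply: ub_ereal_sup => _ [k [X [hX ->]]].
(* F s is the matrix of all Phi evaluated at alpha_(s^-1) X, in the unit ball because alpha is
   completely isometric. Its entries are coefficients, so applying mu entrywise gives the matrix for
   the averaged functionals. *)
pose F s : 'M[C]_(\sum_(i < k) n) := \mxblock_(i < k, j < k)
  map_mx (fun x : A => \matrix_(a < n, b < n) (Phi a b x : C)) (map_mx (alpha s^-1%g) X) i j.
have hF s : (scalar_opnorm (F s) <= 1)%E.
  apply: le_trans hPhi; apply: ereal_sup_ubound.
  exists k, (map_mx (alpha s^-1%g) X); split=> //.
  by rewrite /cstar_os (cstar_mxnorm_act alpha_action).
have FE i j : (fun s => F s i j) = coef (Phi (tagnat.sig2 i) (tagnat.sig2 j))
    (X (tagnat.sig1 i) (tagnat.sig1 j)).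
  by apply/funext => s; rewrite !mxE.
have h1 i j : RUCb (fun s => F s i j) by rewrite FE; exact: coef_RUCb.
have := scalar_opnorm_mu mu_lin mu_norm mu1 h1 hF.
congr (scalar_opnorm _ <= 1)%E; apply/matrixP => i j.
by rewrite [LHS]mxE FE !mxE dual_averageE.
Qed.

End WithMean.
End DualAverageAction.

Unset Implicit Arguments.

Theorem theorem3p3 (R : realType) (A : cstarAlgType R) (G : topGroupType)
    (alpha : G -> A -> A)
    (alpha_action : is_action alpha)
    (alpha_continuous : forall x : A, continuous (fun g : G => alpha g x)) :
  (amenable R G ->
    exists Q : {linear dual A -> dual A},
      [/\ completely_bounded (@dual_os R A) (@dual_os R A) Q,
          forall phi : dual A, Q (Q phi) = Q phi,
          range Q = invariant_functional alpha &
          unital A ->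
            Q @` @state R A `<=` @state R A /\
            Q @` @state R A = @state R A `&` invariant_functional alpha])
  /\
  (compact [set: G] ->
    exists P : {linear A -> A},
      [/\ completely_positive P,
          completely_contractive (@cstar_os R A) (@cstar_os R A) P,
          forall x : A, P (P x) = P x &
          range P = [set x : A | forall g : G, alpha g x = x]]).
Proof.
split=> [[mu [mu_lin mu_norm mu1 mu_inv]]|cG].
  pose q := dual_average alpha_action alpha_continuous mu_lin mu_norm mu1.
  have q_lin : linear q by exact: dual_average_linear.
  pose Q : {linear dual A -> dual A} := HB.pack q (GRing.isLinear.Build _ _ _ _ q q_lin).
  have Qinv phi : invariant_functional alpha (Q phi).
    exact: dual_average_invariant.
  have Qfix phi : invariant_functional alpha phi -> Q phi = phi.
    exact: dual_average_fixed.
  exists Q; split.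
  - exact: dual_average_cb.
  - by move=> phi; exact: Qfix.
  - apply/seteqP; split=> [_ [phi _ <-]//|phi hphi].
    by exists phi => //; exact: Qfix.
  - move=> uA; have Qstate phi : state phi -> state (Q phi).
      exact: dual_average_state.
    split=> [_ [phi hphi <-]|]; first exact: Qstate.
    apply/seteqP; split=> [_ [phi hphi <-]|phi [sphi iphi]].
      by split; [exact: Qstate|exact: Qinv].
    by exists phi => //; exact: Qfix.
pose p := average alpha_continuous cG.
have p_lin : linear p by exact: average_linear.
pose P : {linear A -> A} := HB.pack p (GRing.isLinear.Build _ _ _ _ p p_lin).
have Pinv g x : alpha g (P x) = P x by exact: average_invariant.
have Pfix x : (forall g, alpha g x = x) -> P x = x by exact: average_fixed.
exists P; split.
- exact: average_completely_positive.
- exact: average_completely_contractive.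
- by move=> x; apply: Pfix => g; exact: Pinv.
- apply/seteqP; split=> [_ [x _ <-] g|x hx]; first exact: Pinv.
  by exists x => //; exact: Pfix.
Qed.
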